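(* Let $Y$ be a finite set of symbols, $X \subseteq Y$, and $F$ a ground (quantifier-free) $\sigma_{or}(Y)$-formula. The procedure $\mathtt{consequence}(F,X)$ described below terminates and returns a pair $\langle Z,P\rangle$, reduced with respect to the base monomial ordering $\preceq$, such that $\mathrm{alg.cone}_X(Z,P) = \mathrm{Cn}_X(F)$. Procedure: set $G := F$ and $\langle Z,P\rangle := \langle\{1\},\{0\}\rangle$. While $G$ is satisfiable modulo $\mathbf{LRR}$: let $\langle Z',P'\rangle := \mathtt{get\text{-}model}(G)$; set $\langle Z',P'\rangle := \mathit{project}_X(Z',P')$; set $\langle Z,P\rangle := \mathit{intersect}(Z,P,Z',P')$; set $G := G\land\lnot\big(\bigwedge_{z\in Z} z = 0 \land \bigwedge_{p\in P} 0\le p\big)$. When $G$ is unsatisfiable, return $\langle Z,P\rangle$.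
   Context: $\sigma_{or}$ has $+,\cdot,0,1,=,\le$; $\sigma_{or}(Y)$ adds $Y$ as constants; rational-coefficient atoms abbreviate $\sigma_{or}(Y)$-atoms. $\mathbf{LRR}$ is the $\sigma_{or}$-theory axiomatized by: the commutative ring axioms; reflexivity, transitivity, antisymmetry of $\le$; $\forall x,y,z\,(x\le y\Rightarrow x+z\le y+z)$; $0\le1\land0\ne1$; for each integer $n\ge1$, $\exists x\,(x+\dots+x=1)$; for each integer $n\ge1$, $\forall x\,(0\le x+\dots+x\Rightarrow0\le x)$ ($n$ summands). $\mathrm{Cn}_X(F)=\{p\in\mathbb{Q}[X]: F\models_{\mathbf{LRR}}0\le p\}$. A cone contains $0$ and is closed under addition and non-negative rational scaling; regular if it contains $1$ and its additive units $\{p:p,-p\in C\}$ form an ideal. $\mathrm{alg.cone}_V(Z,P)=\langle Z\rangle_V+\mathrm{cone}(P)$ (ideal of $\mathbb{Q}[V]$ generated by $Z$ plus non-negative rational combinations of $P$). $\langle Z,P\rangle$ is reduced w.r.t. $\preceq$ if $Z$ is a Gröbner basis of $\langle Z\rangle$ and each $p\in P$ is its own normal form modulo $Z$. $\mathtt{get\text{-}model}(G)$: writing each atom as $0\le p$ or $0=p$ (the latter contributing both $0\le p$ and $0\le -p$), it selects a cube $G_i$ (conjunction of literals) of a disjunctive normal form of $G$ that is satisfiable modulo $\mathbf{LRR}$, and returns a reduced pair whose algebraic cone is the least regular cone in $\mathbb{Q}[Y]$ containing the polynomials of the non-negated atoms of $G_i$. $\mathit{project}_X(Z,P)=\langle G\cap\mathbb{Q}[X],\mathrm{proj}(\{\mathbf{red}_G(p):p\in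 P\},[X])\rangle$, with $G$ a Gröbner basis of the ideal generated by $Z$ w.r.t. the elimination ordering $\preceq_X$ (monomials $m_Xm_{\overline X}$ compared first by their part over $Y\setminus X$, then by their part over $X$, using $\preceq$), $[X]$ the monomials over $X$, and $\mathrm{proj}(S,N)$ a finite set with $\mathrm{cone}(\mathrm{proj}(S,N))=\mathrm{cone}(S)\cap\mathrm{span}_{\mathbb{Q}}(N)$ (Fourier–Motzkin). $\mathit{intersect}(Z_1,P_1,Z_2,P_2)=\mathit{project}_X(tZ_1\cup(1-t)Z_2,tP_1\cup(1-t)P_2)$ for a fresh variable $t$, with $fS=\{fs:s\in S\}$.
   Formalization: In get-model, the disjunctive normal form of G must be built only from literals (with their polarity) of the negation normal form of G; with arbitrary disjunctive normal forms, which may add irrelevant positive atoms, the loop need not terminate. *)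

(* Defs.v *)
From HB Require Import structures.
From mathcomp Require Import all_boot all_order all_algebra.
From mathcomp.multinomials Require Import mpoly.
From Stdlib Require List Relation_Operators.

Set Implicit Arguments.
Unset Strict Implicit.
Unset Printing Implicit Defensive.

Import Order.TTheory GRing.Theory Num.Theory.
Local Open Scope ring_scope.

(* All symbols live in the ambient finite set 'I_n.  For W : {set 'I_n}, the
   ring Q[W] is the set of the p : {mpoly rat[n]} whose monomials only involve
   variables of W (poly_over W), and sigma_or(W) only uses constants in W. *)

(** * Ground formulas over sigma_or(Y) *)

Inductive term (n : nat) : Type :=
| TConst (i : 'I_n)
| TZero
| TOne
| TAdd (s u : term n)
| TMul (s u : term n).
Arguments TZero {n}.
Arguments TOne {n}.

Inductive atom (n : nat) : Type :=
| ALe (s u : term n)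
| AEq (s u : term n).

(* Falsity, implication and equivalence are the usual abbreviations. *)
Inductive formula (n : nat) : Type :=
| FTrue
| FAtom (a : atom n)
| FNot (f : formula n)
| FAnd (f g : formula n)
| FOr (f g : formula n).
Arguments FTrue {n}.

Fixpoint tconsts (n : nat) (s : term n) : seq 'I_n :=
  match s with
  | TConst i => [:: i]
  | TZero | TOne => [::]
  | TAdd s u | TMul s u => tconsts s ++ tconsts u
  end.

Definition aconsts (n : nat) (a : atom n) : seq 'I_n :=
  match a with ALe s u | AEq s u => tconsts s ++ tconsts u end.

Fixpoint fconsts (n : nat) (f : formula n) : seq 'I_n :=
  match f with
  | FTrue => [::]
  | FAtom a => aconsts a
  | FNot f => fconsts f
  | FAnd f g | FOr f g => fconsts f ++ fconsts g
  end.

Definition formula_over (n : nat) (Y : {set 'I_n}) (f : formula n) : Prop :=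
  {subset fconsts f <= Y}.

(** * Semantics modulo LRR *)

(* The commutative ring axioms and 0 <> 1 are those of comNzRingType. *)
Record LRR (R : comNzRingType) (le : R -> R -> Prop) : Prop := {
  LRR_refl : forall x, le x x;
  LRR_trans : forall x y z, le x y -> le y z -> le x z;
  LRR_antisym : forall x y, le x y -> le y x -> x = y;
  LRR_add : forall x y z, le x y -> le (x + z) (y + z);
  LRR_le01 : le 0 1;
  LRR_div : forall k : nat, (1 <= k)%N -> exists x : R, x *+ k = 1;
  LRR_unperforated :
    forall k : nat, (1 <= k)%N -> forall x : R, le 0 (x *+ k) -> le 0 x
}.

Fixpoint tval (n : nat) (R : comNzRingType) (v : 'I_n -> R) (s : term n) : R :=
  match s with
  | TConst i => v i
  | TZero => 0
  | TOne => 1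
  | TAdd s u => tval v s + tval v u
  | TMul s u => tval v s * tval v u
  end.

Definition atom_holds (n : nat) (R : comNzRingType) (le : R -> R -> Prop)
    (v : 'I_n -> R) (a : atom n) : Prop :=
  match a with
  | ALe s u => le (tval v s) (tval v u)
  | AEq s u => tval v s = tval v u
  end.

Fixpoint prop_eval (n : nat) (h : atom n -> Prop) (f : formula n) : Prop :=
  match f with
  | FTrue => True
  | FAtom a => h a
  | FNot f => ~ prop_eval h f
  | FAnd f g => prop_eval h f /\ prop_eval h g
  | FOr f g => prop_eval h f \/ prop_eval h g
  end.

Definition holds (n : nat) (R : comNzRingType) (le : R -> R -> Prop)
    (v : 'I_n -> R) (f : formula n) : Prop :=
  prop_eval (atom_holds le v) f.

Definition satisfiable (n : nat) (f : formula n) : Prop :=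
  exists (R : comNzRingType) (le : R -> R -> Prop) (v : 'I_n -> R),
    LRR le /\ holds le v f.

Definition entails (n : nat) (f g : formula n) : Prop :=
  forall (R : comNzRingType) (le : R -> R -> Prop) (v : 'I_n -> R),
    LRR le -> holds le v f -> holds le v g.

(** * Atoms with rational coefficients as abbreviations of sigma_or-atoms *)

Definition term_nat (n k : nat) : term n := iter k (TAdd TOne) TZero.

Definition term_mon (n : nat) (m : 'X_{1..n}) : term n :=
  foldr (fun i s => iter (m i) (TMul (TConst i)) s) TOne (enum 'I_n).

Definition common_den (n : nat) (p : {mpoly rat[n]}) : int :=
  \prod_(m <- msupp p) denq p@_m.

(* The positive and negative parts of (common_den p) * p, which have natural
   number coefficients; 0 <= p stands for  term_neg p <= term_pos p. *)
Definition term_part (n : nat) (p : {mpoly rat[n]}) (s : seq 'X_{1..n})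
    : term n :=
  foldr (@TAdd n) TZero
    [seq TMul (term_nat n (absz (numq ((common_den p)%:~R * p@_m))))
              (term_mon m) | m <- s].

Definition term_pos (n : nat) (p : {mpoly rat[n]}) : term n :=
  term_part p [seq m <- msupp p | 0 < p@_m].

Definition term_neg (n : nat) (p : {mpoly rat[n]}) : term n :=
  term_part p [seq m <- msupp p | p@_m < 0].

Definition FLe0 (n : nat) (p : {mpoly rat[n]}) : formula n :=
  FAtom (ALe (term_neg p) (term_pos p)).

Definition FEq0 (n : nat) (p : {mpoly rat[n]}) : formula n :=
  FAtom (AEq (term_neg p) (term_pos p)).

(** * Q[W], ideals and cones *)

Definition mon_over (n : nat) (W : {set 'I_n}) : pred 'X_{1..n} :=
  fun m => [forall i, (i \notin W) ==> (m i == 0%N)].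

Definition in_span (n : nat) (N : pred 'X_{1..n}) (p : {mpoly rat[n]}) : bool :=
  all N (msupp p).

Definition poly_over (n : nat) (W : {set 'I_n}) (p : {mpoly rat[n]}) : bool :=
  in_span (mon_over W) p.

Definition ideal_gen (n : nat) (W : {set 'I_n}) (Z : seq {mpoly rat[n]})
    (p : {mpoly rat[n]}) : Prop :=
  exists q : 'I_(size Z) -> {mpoly rat[n]},
    (forall i, poly_over W (q i)) /\ p = \sum_(i < size Z) q i * Z`_i.

Definition cone_gen (n : nat) (P : seq {mpoly rat[n]}) (p : {mpoly rat[n]})
    : Prop :=
  exists c : 'I_(size P) -> rat,
    (forall i, 0 <= c i) /\ p = \sum_(i < size P) c i *: P`_i.

(* A pair <Z, P> of finite sets, represented by lists. *)
Definition zp_pair (n : nat) : Type :=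
  (seq {mpoly rat[n]} * seq {mpoly rat[n]})%type.

Definition alg_cone (n : nat) (W : {set 'I_n}) (ZP : zp_pair n)
    (p : {mpoly rat[n]}) : Prop :=
  exists a b, [/\ ideal_gen W ZP.1 a, cone_gen ZP.2 b & p = a + b].

Definition Cn (n : nat) (X : {set 'I_n}) (f : formula n) (p : {mpoly rat[n]})
    : Prop :=
  poly_over X p /\ entails f (FLe0 p).

Definition is_ideal (n : nat) (W : {set 'I_n}) (I : {mpoly rat[n]} -> Prop)
    : Prop :=
  [/\ forall p, I p -> poly_over W p,
      I 0,
      forall p q, I p -> I q -> I (p + q)
    & forall p q, poly_over W p -> I q -> I (p * q)].

Definition is_cone (n : nat) (W : {set 'I_n}) (C : {mpoly rat[n]} -> Prop)
    : Prop :=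
  [/\ forall p, C p -> poly_over W p,
      C 0,
      forall p q, C p -> C q -> C (p + q)
    & forall (c : rat) p, 0 <= c -> C p -> C (c *: p)].

Definition regular_cone (n : nat) (W : {set 'I_n}) (C : {mpoly rat[n]} -> Prop)
    : Prop :=
  [/\ is_cone W C, C 1 & is_ideal W (fun p => C p /\ C (- p))].

Definition least_regular_cone (n : nat) (W : {set 'I_n})
    (S : seq {mpoly rat[n]}) (C : {mpoly rat[n]} -> Prop) : Prop :=
  [/\ regular_cone W C,
      forall p, p \in S -> C p
    & forall C', regular_cone W C' -> (forall p, p \in S -> C' p) ->
        forall p, C p -> C' p].

(** * Monomial orderings, Groebner bases, reduced pairs *)

Record monomial_order (n : nat) (le : rel 'X_{1..n}) : Prop := {
  mo_refl : reflexive le;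
  mo_antisym : antisymmetric le;
  mo_trans : transitive le;
  mo_total : total le;
  mo_one : forall m, le 0%MM m;
  mo_mul : forall m1 m2 m : 'X_{1..n}, le m1 m2 -> le (m1 + m)%MM (m2 + m)%MM
}.

Definition mon_part (n : nat) (W : {set 'I_n}) (m : 'X_{1..n}) : 'X_{1..n} :=
  [multinom (if i \in W then m i else 0%N) | i < n].

(* The elimination ordering; on monomials over a set V of variables, the part
   over ~: X is the part over V :\: X. *)
Definition elim_order (n : nat) (le : rel 'X_{1..n}) (X : {set 'I_n})
    : rel 'X_{1..n} :=
  fun m1 m2 =>
    if mon_part (~: X) m1 == mon_part (~: X) m2
    then le (mon_part X m1) (mon_part X m2)
    else le (mon_part (~: X) m1) (mon_part (~: X) m2).

(* The zero polynomial has no leading monomial. *)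
Definition lead_mon (n : nat) (le : rel 'X_{1..n}) (p : {mpoly rat[n]})
    (m : 'X_{1..n}) : Prop :=
  m \in msupp p /\ forall m', m' \in msupp p -> le m' m.

(* G is a Groebner basis of the ideal of Q[W] generated by Z. *)
Definition groebner (n : nat) (le : rel 'X_{1..n}) (W : {set 'I_n})
    (G Z : seq {mpoly rat[n]}) : Prop :=
  (forall p, ideal_gen W G p <-> ideal_gen W Z p) /\
  (forall p m, ideal_gen W Z p -> lead_mon le p m ->
     exists g m', [/\ g \in G, lead_mon le g m' & (m' <= m)%MM]).

(* When G is a Groebner basis, r is unique: it is red_G(p). *)
Definition normal_form (n : nat) (le : rel 'X_{1..n}) (W : {set 'I_n})
    (G : seq {mpoly rat[n]}) (p r : {mpoly rat[n]}) : Prop :=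
  ideal_gen W G (p - r) /\
  (forall m g m', m \in msupp r -> g \in G -> lead_mon le g m' ->
     ~~ (m' <= m)%MM).

Definition reduced (n : nat) (le : rel 'X_{1..n}) (W : {set 'I_n})
    (ZP : zp_pair n) : Prop :=
  groebner le W ZP.1 ZP.1 /\
  (forall p, p \in ZP.2 -> normal_form le W ZP.1 p p).

(** * The sub-procedures, as relations between arguments and results *)

(* (true, a) is the literal a and (false, a) is its negation. *)
Definition literal (n : nat) : Type := (bool * atom n)%type.
Definition cube (n : nat) : Type := seq (literal n).

Definition literal_formula (n : nat) (l : literal n) : formula n :=
  if l.1 then FAtom l.2 else FNot (FAtom l.2).

Definition cube_formula (n : nat) (c : cube n) : formula n :=
  foldr (fun l f => FAnd (literal_formula l) f) FTrue c.

(* The literals of the negation normal form of f (b = true) or ~ f (b = false). *)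
Fixpoint nnf_literals (n : nat) (b : bool) (f : formula n) : seq (literal n) :=
  match f with
  | FTrue => [::]
  | FAtom a => [:: (b, a)]
  | FNot f => nnf_literals (~~ b) f
  | FAnd f g | FOr f g => nnf_literals b f ++ nnf_literals b g
  end.

(* D is a disjunctive normal form of f: a disjunction of cubes that is
   propositionally equivalent to f and built, as in the usual conversion, from
   the literals of the negation normal form of f.  (Without the latter, cubes
   could contain irrelevant positive atoms.) *)
Definition is_dnf (n : nat) (D : seq (cube n)) (f : formula n) : Prop :=
  (forall c l, List.In c D -> List.In l c -> List.In l (nnf_literals true f)) /\
  (forall h : atom n -> Prop,
     prop_eval h f <-> exists c, List.In c D /\ prop_eval h (cube_formula c)).

Definition term_poly (n : nat) (s : term n) : {mpoly rat[n]} :=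
  tval (fun i : 'I_n => 'X_i : {mpoly rat[n]}) s.

Definition literal_polys (n : nat) (l : literal n) : seq {mpoly rat[n]} :=
  match l with
  | (true, ALe s u) => [:: term_poly u - term_poly s]
  | (true, AEq s u) =>
      [:: term_poly u - term_poly s; - (term_poly u - term_poly s)]
  | (false, _) => [::]
  end.

Definition cube_polys (n : nat) (c : cube n) : seq {mpoly rat[n]} :=
  flatten [seq literal_polys l | l <- c].

Definition get_model (n : nat) (le : rel 'X_{1..n}) (Y : {set 'I_n})
    (G : formula n) (ZP : zp_pair n) : Prop :=
  exists (D : seq (cube n)) (c : cube n),
    [/\ is_dnf D G,
        List.In c D,
        satisfiable (cube_formula c),
        reduced le Y ZP
      & least_regular_cone Y (cube_polys c) (alg_cone Y ZP)].

(* P is a possible value of proj(S, N). *)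
Definition is_proj (n : nat) (S : seq {mpoly rat[n]}) (N : pred 'X_{1..n})
    (P : seq {mpoly rat[n]}) : Prop :=
  forall p, cone_gen P p <-> cone_gen S p /\ in_span N p.

(* project_X on pairs of finite subsets of Q[V]. *)
Definition project (n : nat) (le : rel 'X_{1..n}) (V X : {set 'I_n})
    (ZP ZP' : zp_pair n) : Prop :=
  exists G S : seq {mpoly rat[n]},
    [/\ groebner (elim_order le X) V G ZP.1,
        forall s, s \in S <->
          exists2 p, p \in ZP.2 & normal_form (elim_order le X) V G p s,
        ZP'.1 = [seq g <- G | poly_over X g]
      & is_proj S (mon_over X) ZP'.2].

Definition scale_seq (n : nat) (f : {mpoly rat[n]}) (S : seq {mpoly rat[n]})
    : seq {mpoly rat[n]} :=
  [seq f * s | s <- S].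

Definition intersect (n : nat) (le : rel 'X_{1..n}) (X : {set 'I_n}) (t : 'I_n)
    (ZP1 ZP2 ZP' : zp_pair n) : Prop :=
  project le (t |: X) X
    (scale_seq 'X_t ZP1.1 ++ scale_seq (1 - 'X_t) ZP2.1,
     scale_seq 'X_t ZP1.2 ++ scale_seq (1 - 'X_t) ZP2.2) ZP'.

(** * The procedure consequence(F, X) *)

Definition zp_formula (n : nat) (ZP : zp_pair n) : formula n :=
  FAnd (foldr (fun z f => FAnd (FEq0 z) f) FTrue ZP.1)
       (foldr (fun p f => FAnd (FLe0 p) f) FTrue ZP.2).

(* Control points, with the values of the live variables: the loop test, before
   the call to project, before the call to intersect, and after the return. *)
Inductive config (n : nat) : Type :=
| AtTest (G : formula n) (ZP : zp_pair n)
| AtProject (G : formula n) (ZP ZP' : zp_pair n)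
| AtIntersect (G : formula n) (ZP ZP' : zp_pair n)
| Returned (ZP : zp_pair n).

Inductive step (n : nat) (le : rel 'X_{1..n}) (Y X : {set 'I_n}) (t : 'I_n)
    : config n -> config n -> Prop :=
| step_get_model G ZP ZP' :
    satisfiable G -> get_model le Y G ZP' ->
    step le Y X t (AtTest G ZP) (AtProject G ZP ZP')
| step_project G ZP ZP' ZP'' :
    project le Y X ZP' ZP'' ->
    step le Y X t (AtProject G ZP ZP') (AtIntersect G ZP ZP'')
| step_intersect G ZP ZP' ZP'' :
    intersect le X t ZP ZP' ZP'' ->
    step le Y X t (AtIntersect G ZP ZP')
                  (AtTest (FAnd G (FNot (zp_formula ZP''))) ZP'')
| step_return G ZP :
    ~ satisfiable G ->
    step le Y X t (AtTest G ZP) (Returned ZP).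

Definition initial (n : nat) (F : formula n) : config n :=
  AtTest F ([:: 1], [:: 0]).

Definition reachable (n : nat) (le : rel 'X_{1..n}) (Y X : {set 'I_n})
    (t : 'I_n) (F : formula n) (c : config n) : Prop :=
  Relation_Operators.clos_refl_trans _ (step le Y X t) (initial F) c.

(* Every execution is finite, and one that cannot be continued has returned. *)
Definition consequence_terminates (n : nat) (le : rel 'X_{1..n})
    (Y X : {set 'I_n}) (t : 'I_n) (F : formula n) : Prop :=
  Acc (fun c' c => step le Y X t c c') (initial F) /\
  forall c, reachable le Y X t F c ->
    (exists c', step le Y X t c c') \/ (exists ZP, c = Returned ZP).

Definition consequence_returns (n : nat) (le : rel 'X_{1..n})
    (Y X : {set 'I_n}) (t : 'I_n) (F : formula n) (ZP : zp_pair n) : Prop :=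
  reachable le Y X t F (Returned ZP).

(* Main.v *)
Require Import Defs.
From HB Require Import structures.
From mathcomp Require Import all_boot all_order all_algebra ring boolp.
From mathcomp.multinomials Require Import mpoly.
From Stdlib Require List.

Set Implicit Arguments.
Unset Strict Implicit.
Unset Printing Implicit Defensive.

Import Order.TTheory GRing.Theory Num.Theory.
Local Open Scope ring_scope.

(** The loop enumerates cubes [c] of disjunctive normal forms.  The polynomials
   that are non-negative at a model of LRR form a regular cone; conversely, the
   quotient of [Q[Y]] by the additive units of a regular cone [C] that does not
   contain [-1], ordered by [C], is a model of LRR.  When [c] is satisfiable and
   [C] is the least regular cone containing its positive atoms, this model
   satisfies [c], negated atoms included, because [C] is below the cone of any
   model of [c].  So [C] consists exactly of the consequences of [c], and
   projecting to [Q[X]] and intersecting over the cubes yields the consequences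
   of [F].

   The negated conjunctions added to [G] contribute no positive atom, so the
   cone of a cube is determined by a subset of the positive atoms of [F], and
   each iteration excludes one of these finitely many subsets. *)

(** * Polynomials over a set of variables *)

Section MonomialsOver.
Variable n : nat.
Implicit Types (W : {set 'I_n}) (m : 'X_{1..n}).

Lemma mon_overP W m :
  reflect (forall i, i \notin W -> m i = 0%N) (mon_over W m).
Proof.
apply: (iffP forallP) => [mW i iW|mW i]; first exact/eqP/(implyP (mW i)).
by apply/implyP => /mW ->.
Qed.

Lemma mon_over_le W m m' : (m' <= m)%MM -> mon_over W m -> mon_over W m'.
Proof.
move=> /mnm_lepP le_m /mon_overP mW; apply/mon_overP => i /mW mi0.
by apply/eqP; rewrite -leqn0 -mi0.
Qed.

Lemma mon_overD W m m' :
  mon_over W m -> mon_over W m' -> mon_over W (m + m')%MM.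
Proof.
move=> /mon_overP mW /mon_overP m'W; apply/mon_overP => i iW.
by rewrite mnmDE mW // m'W.
Qed.

Lemma mon_overS W W' m : W \subset W' -> mon_over W m -> mon_over W' m.
Proof.
move=> /subsetP sWW' /mon_overP mW; apply/mon_overP => i iW'.
by apply: mW; apply: contra iW' => /sWW'.
Qed.

Lemma mon_over0 W : mon_over W 0%MM.
Proof. by apply/mon_overP => i _; rewrite mnm0E. Qed.

Lemma mon_overU W i : i \in W -> mon_over W U_(i)%MM.
Proof.
move=> iW; apply/mon_overP => j jW.
by rewrite mnm1E; case: eqVneq jW => // <-; rewrite iW.
Qed.

End MonomialsOver.

Section Span.
Variables (n : nat) (N : pred 'X_{1..n}).
Implicit Types (p q : {mpoly rat[n]}).

Lemma in_span0 : in_span N 0.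
Proof. by rewrite /in_span msupp0. Qed.

Lemma in_spanD p q : in_span N p -> in_span N q -> in_span N (p + q).
Proof.
move=> /allP pN /allP qN; apply/allP => m /msuppD_le.
by rewrite mem_cat => /orP[/pN|/qN].
Qed.

Lemma in_spanZ c p : in_span N p -> in_span N (c *: p).
Proof. by move=> /allP pN; apply/allP => m /msuppZ_le /pN. Qed.

Lemma in_spanB p q : in_span N p -> in_span N q -> in_span N (p - q).
Proof. by move=> pN qN; rewrite -scaleN1r; apply/in_spanD/in_spanZ. Qed.

Lemma in_spanX m : in_span N 'X_[m] = N m.
Proof. by rewrite /in_span msuppX /= andbT. Qed.

End Span.

Section PolyOver.
Variable n : nat.
Implicit Types (W : {set 'I_n}) (p q : {mpoly rat[n]}) (m : 'X_{1..n}).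

Lemma poly_overP W p :
  reflect {in msupp p, forall m, mon_over W m} (poly_over W p).
Proof. exact: allP. Qed.

Lemma poly_over0 W : poly_over W 0.
Proof. exact: in_span0. Qed.

Lemma poly_overX W m : poly_over W 'X_[m] = mon_over W m.
Proof. exact: in_spanX. Qed.

Lemma poly_overXU W i : i \in W -> poly_over W 'X_i.
Proof. by move=> iW; rewrite poly_overX mon_overU. Qed.

Lemma poly_over1 W : poly_over W 1.
Proof. by rewrite -mpolyX0 poly_overX mon_over0. Qed.

Lemma poly_overD W p q : poly_over W p -> poly_over W q -> poly_over W (p + q).
Proof. exact: in_spanD. Qed.

Lemma poly_overZ W c p : poly_over W p -> poly_over W (c *: p).
Proof. exact: in_spanZ. Qed.

Lemma poly_overC W c : poly_over W c%:MP.
Proof. by rewrite -alg_mpolyC; apply/poly_overZ/poly_over1. Qed.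

Lemma poly_overB W p q : poly_over W p -> poly_over W q -> poly_over W (p - q).
Proof. exact: in_spanB. Qed.

Lemma poly_overN W p : poly_over W p -> poly_over W (- p).
Proof. by rewrite -sub0r; apply/poly_overB/poly_over0. Qed.

Lemma poly_overM W p q : poly_over W p -> poly_over W q -> poly_over W (p * q).
Proof.
move=> /poly_overP pW /poly_overP qW; apply/poly_overP => m /msuppM_le.
by case/allpairsP => -[m1 m2] /= [/pW m1W /qW m2W ->]; apply: mon_overD.
Qed.

Lemma poly_over_exp W p k : poly_over W p -> poly_over W (p ^+ k).
Proof.
move=> pW; elim: k => [|k IH]; first by rewrite expr0 poly_over1.
by rewrite exprS; apply: poly_overM.
Qed.

Lemma poly_overS W W' p : W \subset W' -> poly_over W p -> poly_over W' p.
Proof. by move=> sWW'; apply: sub_all => m; apply: mon_overS. Qed.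

Lemma poly_overT p : poly_over setT p.
Proof. by apply/poly_overP => m _; apply/mon_overP => i; rewrite inE. Qed.

End PolyOver.

Section Substitution.
Variables (n k : nat) (W : {set 'I_n}) (lq : n.-tuple {mpoly rat[k]}).
Implicit Type p : {mpoly rat[n]}.

Lemma comp_mpoly_over (W' : {set 'I_k}) p :
  {in W, forall i, poly_over W' (tnth lq i)} -> poly_over W p ->
  poly_over W' (p \mPo lq).
Proof.
move=> lqW' /poly_overP pW; rewrite comp_mpolyE big_seq.
apply: (big_ind (poly_over W')) => [||m /pW /mon_overP mW].
- exact: poly_over0.
- exact: poly_overD.
apply: poly_overZ; apply: (big_ind (poly_over W')) => [||i _].
- exact: poly_over1.
- exact: poly_overM.
have [iW|/mW ->] := boolP (i \in W); last by rewrite expr0 poly_over1.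
exact/poly_over_exp/lqW'.
Qed.

End Substitution.

Lemma comp_mpoly_id_over n (W : {set 'I_n}) (lq : n.-tuple {mpoly rat[n]}) p :
  {in W, forall i, tnth lq i = 'X_i} -> poly_over W p -> p \mPo lq = p.
Proof.
move=> lqX /poly_overP pW; rewrite comp_mpolyE [RHS]mpolyE.
apply: eq_big_seq => m /pW /mon_overP mW; congr (_ *: _).
rewrite mpolyXE_id; apply: eq_bigr => i _.
by have [/lqX ->|/mW ->] := boolP (i \in W); rewrite ?expr0.
Qed.

(** * Ideals, cones and algebraic cones *)

Section IdealsCones.
Variable n : nat.
Implicit Types (W : {set 'I_n}) (p q : {mpoly rat[n]}).
Implicit Types (Z P S : seq {mpoly rat[n]}) (ZP : zp_pair n).

Lemma ideal_gen0 W Z : ideal_gen W Z 0.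
Proof.
exists (fun _ => 0); split => [i|]; first exact: poly_over0.
by rewrite big1 // => i _; rewrite mul0r.
Qed.

Lemma ideal_genD W Z p q :
  ideal_gen W Z p -> ideal_gen W Z q -> ideal_gen W Z (p + q).
Proof.
move=> [a [aW ->]] [b [bW ->]]; exists (fun i => a i + b i).
split => [i|]; first exact: poly_overD.
by rewrite -big_split; apply: eq_bigr => i _; rewrite mulrDl.
Qed.

Lemma ideal_genM W Z p q :
  poly_over W p -> ideal_gen W Z q -> ideal_gen W Z (p * q).
Proof.
move=> pW [a [aW ->]]; exists (fun i => p * a i).
split => [i|]; first exact: poly_overM.
by rewrite mulr_sumr; apply: eq_bigr => i _; rewrite mulrA.
Qed.

Lemma ideal_genZ W Z c q : ideal_gen W Z q -> ideal_gen W Z (c *: q).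
Proof. by rewrite -mul_mpolyC; apply/ideal_genM/poly_overC. Qed.

Lemma ideal_genN W Z q : ideal_gen W Z q -> ideal_gen W Z (- q).
Proof. by rewrite -scaleN1r; apply: ideal_genZ. Qed.

Lemma ideal_genB W Z p q :
  ideal_gen W Z p -> ideal_gen W Z q -> ideal_gen W Z (p - q).
Proof. by move=> Zp Zq; apply/ideal_genD/ideal_genN. Qed.

Lemma ideal_gen_mem W Z z : z \in Z -> ideal_gen W Z z.
Proof.
rewrite -index_mem => lt_z; exists (fun i => (i == Ordinal lt_z)%:R).
split => [i|]; first by case: eqP => _; rewrite ?poly_over0 ?poly_over1.
rewrite (bigD1 (Ordinal lt_z)) //= eqxx mul1r nth_index -?index_mem //.
by rewrite big1 ?addr0 // => i /negbTE ->; rewrite mul0r.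
Qed.

Lemma ideal_gen_ind W Z (I : {mpoly rat[n]} -> Prop) :
  I 0 -> (forall p q, I p -> I q -> I (p + q)) ->
  (forall p z, poly_over W p -> z \in Z -> I (p * z)) ->
  forall p, ideal_gen W Z p -> I p.
Proof.
move=> I0 ID IM p [a [aW ->]]; apply: big_ind => // i _.
by apply: IM => //; apply: mem_nth.
Qed.

Lemma ideal_gen_over W Z :
  {in Z, forall z, poly_over W z} ->
  forall p, ideal_gen W Z p -> poly_over W p.
Proof.
move=> ZW; apply: ideal_gen_ind; [exact: poly_over0|exact: poly_overD|].
by move=> p z pW /ZW; apply: poly_overM.
Qed.

Lemma ideal_gen_sub W W' Z Z' :
  W \subset W' -> {in Z, forall z, ideal_gen W' Z' z} ->
  forall p, ideal_gen W Z p -> ideal_gen W' Z' p.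
Proof.
move=> sWW' ZZ'; apply: ideal_gen_ind; [exact: ideal_gen0|exact: ideal_genD|].
by move=> p z pW /ZZ'; apply: ideal_genM; apply: poly_overS pW.
Qed.

Lemma cone_gen0 P : cone_gen P 0.
Proof.
by exists (fun _ => 0); split => //; rewrite big1 // => i _; rewrite scale0r.
Qed.

Lemma cone_genD P p q : cone_gen P p -> cone_gen P q -> cone_gen P (p + q).
Proof.
move=> [a [a_ge0 ->]] [b [b_ge0 ->]]; exists (fun i => a i + b i).
split => [i|]; first exact: addr_ge0.
by rewrite -big_split; apply: eq_bigr => i _; rewrite scalerDl.
Qed.

Lemma cone_genZ P c p : 0 <= c -> cone_gen P p -> cone_gen P (c *: p).
Proof.
move=> c_ge0 [a [a_ge0 ->]]; exists (fun i => c * a i).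
split => [i|]; first exact: mulr_ge0.
by rewrite scaler_sumr; apply: eq_bigr => i _; rewrite scalerA.
Qed.

Lemma cone_gen_mem P p : p \in P -> cone_gen P p.
Proof.
rewrite -index_mem => lt_p; exists (fun i => (i == Ordinal lt_p)%:R).
split => [i|]; first exact: ler0n.
rewrite (bigD1 (Ordinal lt_p)) //= eqxx scale1r nth_index -?index_mem //.
by rewrite big1 ?addr0 // => i /negbTE ->; rewrite scale0r.
Qed.

Lemma cone_gen_ind P (C : {mpoly rat[n]} -> Prop) :
  C 0 -> (forall p q, C p -> C q -> C (p + q)) ->
  (forall c p, 0 <= c -> p \in P -> C (c *: p)) ->
  forall p, cone_gen P p -> C p.
Proof.
move=> C0 CD CZ p [a [a_ge0 ->]]; apply: big_ind => // i _.
by apply: CZ => //; apply: mem_nth.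
Qed.

Lemma cone_gen_ind_gt0 P (C : {mpoly rat[n]} -> Prop) :
  (forall p q, C p -> C q -> C (p + q)) ->
  (forall c p, 0 < c -> p \in P -> C (c *: p)) ->
  forall p, cone_gen P p -> p = 0 \/ C p.
Proof.
move=> CD CZ; apply: cone_gen_ind; first by left.
  move=> p q [->|Cp] [->|Cq]; rewrite ?addr0 ?add0r; do ?by left.
  - by right.
  - by right.
  by right; apply: CD.
move=> c p; rewrite le_eqVlt => /orP[/eqP <- _|c_gt0 pP].
  by left; rewrite scale0r.
by right; apply: CZ.
Qed.

Lemma cone_gen_in_span P (N : pred 'X_{1..n}) :
  {in P, forall p, in_span N p} -> forall p, cone_gen P p -> in_span N p.
Proof.
move=> PN; apply: cone_gen_ind; [exact: in_span0|exact: in_spanD|].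
by move=> c p _ /PN; apply: in_spanZ.
Qed.

Lemma alg_cone_ideal W ZP p : ideal_gen W ZP.1 p -> alg_cone W ZP p.
Proof. by exists p, 0; rewrite addr0; split=> //; apply: cone_gen0. Qed.

Lemma alg_cone_cone W ZP p : cone_gen ZP.2 p -> alg_cone W ZP p.
Proof. by exists 0, p; rewrite add0r; split=> //; apply: ideal_gen0. Qed.

Lemma alg_cone0 W ZP : alg_cone W ZP 0.
Proof. exact/alg_cone_ideal/ideal_gen0. Qed.

Lemma alg_coneD W ZP p q :
  alg_cone W ZP p -> alg_cone W ZP q -> alg_cone W ZP (p + q).
Proof.
move=> [a [b [Za Pb ->]]] [a' [b' [Za' Pb' ->]]]; exists (a + a'), (b + b').
split; [exact: ideal_genD|exact: cone_genD|by rewrite addrACA].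
Qed.

Lemma alg_coneZ W ZP c p : 0 <= c -> alg_cone W ZP p -> alg_cone W ZP (c *: p).
Proof.
move=> c_ge0 [a [b [Za Pb ->]]]; exists (c *: a), (c *: b).
split; [exact: ideal_genZ|exact: cone_genZ|by rewrite scalerDr].
Qed.

Lemma alg_cone_ind W ZP (C : {mpoly rat[n]} -> Prop) :
  (forall p q, C p -> C q -> C (p + q)) ->
  (forall p, ideal_gen W ZP.1 p -> C p) ->
  (forall c p, 0 <= c -> p \in ZP.2 -> C (c *: p)) ->
  forall p, alg_cone W ZP p -> C p.
Proof.
move=> CD CI CZ p [a [b [Za Pb ->]]]; apply: (CD); first exact: CI.
by move: b Pb; apply: cone_gen_ind => //; apply/CI/ideal_gen0.
Qed.

Lemma alg_cone_sub W W' ZP ZP' : W \subset W' ->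
  {in ZP.1, forall z, ideal_gen W' ZP'.1 z} ->
  {in ZP.2, forall p, alg_cone W' ZP' p} ->
  forall p, alg_cone W ZP p -> alg_cone W' ZP' p.
Proof.
move=> sWW' Zsub Psub; apply: alg_cone_ind; first exact: alg_coneD.
  by move=> p Zp; apply: alg_cone_ideal; apply: ideal_gen_sub Zp.
by move=> c p c_ge0 /Psub; apply: alg_coneZ.
Qed.

Lemma alg_cone_linear W W' ZP ZP'
    (phi : {linear {mpoly rat[n]} -> {mpoly rat[n]}}) :
  (forall q z, poly_over W q -> z \in ZP.1 ->
     ideal_gen W' ZP'.1 (phi (q * z))) ->
  {in ZP.2, forall p, cone_gen ZP'.2 (phi p)} ->
  forall p, alg_cone W ZP p -> alg_cone W' ZP' (phi p).
Proof.
move=> phiZ phiP; apply: alg_cone_ind.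
- by move=> p q; rewrite linearD; apply: alg_coneD.
- move=> p Zp; apply: alg_cone_ideal.
  move: p Zp; apply: ideal_gen_ind => // [|p q].
    by rewrite linear0; apply: ideal_gen0.
  by rewrite linearD; apply: ideal_genD.
move=> c p c_ge0 /phiP phi_p; rewrite linearZ.
exact/alg_coneZ/alg_cone_cone.
Qed.

(* If c *: p + r lies in <Z> with p in P, c > 0 and r in cone(P), then - p lies
   in <Z> + cone(P), so p lies in <Z>. *)
Lemma cone_gen_face W ZP :
  (forall p, p \in ZP.2 -> alg_cone W ZP (- p) -> ideal_gen W ZP.1 p) ->
  forall p r, cone_gen ZP.2 p -> cone_gen ZP.2 r -> ideal_gen W ZP.1 (p + r) ->
  ideal_gen W ZP.1 p.
Proof.
move=> ZP_units p r Pp; suff [_] : cone_gen ZP.2 p /\ forall s,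
  cone_gen ZP.2 s -> ideal_gen W ZP.1 (p + s) -> ideal_gen W ZP.1 p by apply.
move: p Pp {r}; apply: cone_gen_ind => [|p q [Pp Ip] [Pq Iq]|c p c_ge0 pP].
- by split=> [|r _ _]; [apply: cone_gen0|apply: ideal_gen0].
- split=> [|r Pr Zpqr]; first exact: cone_genD.
  apply: ideal_genD.
    by apply: (Ip (q + r)); [apply: cone_genD|rewrite addrA].
  by apply: (Iq (p + r)); [apply: cone_genD|rewrite addrCA addrA].
split=> [|r Pr Zpr]; first exact/cone_genZ/cone_gen_mem.
have [->|c_neq0] := eqVneq c 0; first by rewrite scale0r; apply: ideal_gen0.
apply/ideal_genZ/ZP_units => //.
have -> : - p = c^-1 *: (r - (c *: p + r)).
  by rewrite opprD addrCA subrr addr0 scalerN scalerA mulVf ?scale1r.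
apply: alg_coneZ; first by rewrite invr_ge0.
by apply: alg_coneD; [apply: alg_cone_cone|apply/alg_cone_ideal/ideal_genN].
Qed.

Lemma alg_cone_units W ZP :
  (forall p, p \in ZP.2 -> alg_cone W ZP (- p) -> ideal_gen W ZP.1 p) ->
  forall p, alg_cone W ZP p /\ alg_cone W ZP (- p) <-> ideal_gen W ZP.1 p.
Proof.
move=> ZP_units p; split=> [[[a [b [Za Pb pE]]] [a' [b' [Za' Pb' NpE]]]]|Zp].
  rewrite pE; apply: ideal_genD => //; apply: (cone_gen_face ZP_units Pb Pb').
  have -> : b + b' = - (a + a').
    by apply/eqP; rewrite -addr_eq0 addrC addrACA -pE -NpE subrr.
  exact/ideal_genN/ideal_genD.
by split; apply: alg_cone_ideal; last exact: ideal_genN.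
Qed.

Definition zp_over W ZP : Prop :=
  {in ZP.1, forall z, poly_over W z} /\ {in ZP.2, forall p, poly_over W p}.

Lemma alg_cone_over W ZP : zp_over W ZP ->
  forall p, alg_cone W ZP p -> poly_over W p.
Proof.
move=> [ZW PW]; apply: alg_cone_ind; first exact: poly_overD.
  exact: ideal_gen_over.
by move=> c p _ /PW; apply: poly_overZ.
Qed.

End IdealsCones.

(** * Fourier-Motzkin elimination *)

Section FourierMotzkin.
Variables (n : nat) (m : 'X_{1..n}).
Implicit Types (p q : {mpoly rat[n]}) (P S : seq {mpoly rat[n]}).

Definition cancel_comb p q : {mpoly rat[n]} := (- q@_m) *: p + p@_m *: q.

Lemma mcoeff_cancel_comb p q : (cancel_comb p q)@_m = 0.
Proof. by rewrite mcoeffD !mcoeffZ; ring. Qed.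

Lemma cancel_combDl p p' q :
  cancel_comb (p + p') q = cancel_comb p q + cancel_comb p' q.
Proof. by rewrite /cancel_comb scalerDr mcoeffD scalerDl addrACA. Qed.

Lemma cancel_combDr p q q' :
  cancel_comb p (q + q') = cancel_comb p q + cancel_comb p q'.
Proof. by rewrite /cancel_comb mcoeffD opprD scalerDl scalerDr addrACA. Qed.

Lemma cancel_combZl c p q : cancel_comb (c *: p) q = c *: cancel_comb p q.
Proof. by rewrite /cancel_comb mcoeffZ scalerDr !scalerA mulrC. Qed.

Lemma cancel_combZr c p q : cancel_comb p (c *: q) = c *: cancel_comb p q.
Proof.
by rewrite /cancel_comb mcoeffZ scalerDr !scalerA mulrN mulrC [c * p@_m]mulrC.
Qed.

Lemma cone_gen_cancel_comb S1 S2 P :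
  (forall p q, p \in S1 -> q \in S2 -> cone_gen P (cancel_comb p q)) ->
  forall p q, cone_gen S1 p -> cone_gen S2 q -> cone_gen P (cancel_comb p q).
Proof.
move=> S12 p q S1p S2q; move: p S1p; apply: cone_gen_ind => [|p p' Pp Pp'|].
- by rewrite -(scale0r 0) cancel_combZl scale0r; apply: cone_gen0.
- by rewrite cancel_combDl; apply: cone_genD.
move=> c p c_ge0 pS1; rewrite cancel_combZl; apply: cone_genZ => //.
move: q S2q; apply: cone_gen_ind => [|q q' Pq Pq'|d q d_ge0 qS2].
- by rewrite -(scale0r 0) cancel_combZr scale0r; apply: cone_gen0.
- by rewrite cancel_combDr; apply: cone_genD.
by rewrite cancel_combZr; apply: cone_genZ => //; apply: S12.
Qed.

Definition coeff_eq0 S := [seq p <- S | p@_m == 0].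
Definition coeff_gt0 S := [seq p <- S | 0 < p@_m].
Definition coeff_lt0 S := [seq p <- S | p@_m < 0].

Definition fourier_motzkin_step S : seq {mpoly rat[n]} :=
  coeff_eq0 S ++ [seq cancel_comb p q | p <- coeff_gt0 S, q <- coeff_lt0 S].

Lemma fourier_motzkin_stepP S p :
  reflect (p \in S /\ p@_m = 0 \/
           exists u v, [/\ u \in coeff_gt0 S, v \in coeff_lt0 S
                         & p = cancel_comb u v])
          (p \in fourier_motzkin_step S).
Proof.
rewrite mem_cat mem_filter; apply: (iffP orP).
- case=> [/andP[/eqP pm pS]|/allpairsP[[u v] [uS vS ->]]]; first by left.
  by right; exists u, v.
- case=> [[pS /eqP pm]|[u [v [uS vS ->]]]]; first by left; rewrite pm.
  by right; apply: allpairs_f.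
Qed.

Lemma fourier_motzkin_step_in_span S (N : pred 'X_{1..n}) :
  {in S, forall p, in_span N p} ->
  {in fourier_motzkin_step S, forall p, in_span (predI N (predC1 m)) p}.
Proof.
move=> SN p pS'; have pN : in_span N p.
  case/fourier_motzkin_stepP: pS' => [[/SN //]|[u [v [uS vS ->]]]].
  move: uS vS; rewrite !mem_filter => /andP[_ uS] /andP[_ vS].
  by apply: in_spanD; apply/in_spanZ/SN.
have pm : p@_m = 0.
  case/fourier_motzkin_stepP: pS' => [[]//|[u [v [_ _ ->]]]].
  exact: mcoeff_cancel_comb.
apply/allP => m' m'p /=; rewrite (allP pN) //=.
by apply: contraTneq m'p => ->; rewrite mcoeff_msupp pm eqxx.
Qed.

Lemma cone_gen_sign_split S p : cone_gen S p ->
  exists a b c, [/\ cone_gen (coeff_eq0 S) a, cone_gen (coeff_gt0 S) b,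
                    cone_gen (coeff_lt0 S) c & p = a + b + c].
Proof.
move: p; apply: cone_gen_ind.
- by exists 0, 0, 0; rewrite !addr0; split => //; apply: cone_gen0.
- move=> p q [a [b [c [Sa Sb Sc ->]]]] [a' [b' [c' [Sa' Sb' Sc' ->]]]].
  exists (a + a'), (b + b'), (c + c'); split; do ?exact: cone_genD.
  by rewrite addrACA [a + b + _]addrACA.
move=> d p d_ge0 pS; case: (ltgtP p@_m 0) => pm.
- exists 0, 0, (d *: p); rewrite !add0r; split => //; do ?exact: cone_gen0.
  by apply/cone_genZ/cone_gen_mem => //; rewrite mem_filter pm.
- exists 0, (d *: p), 0; rewrite add0r addr0; split => //; do ?exact: cone_gen0.
  by apply/cone_genZ/cone_gen_mem => //; rewrite mem_filter pm.
exists (d *: p), 0, 0; rewrite !addr0; split => //; do ?exact: cone_gen0.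
by apply/cone_genZ/cone_gen_mem => //; rewrite mem_filter pm eqxx.
Qed.

Lemma cone_gen_coeff_eq0 S p : cone_gen (coeff_eq0 S) p -> p@_m = 0.
Proof.
move: p; apply: cone_gen_ind => [|p q pm qm|c p _]; first exact: mcoeff0.
  by rewrite mcoeffD pm qm addr0.
by rewrite mem_filter mcoeffZ => /andP[/eqP -> _]; rewrite mulr0.
Qed.

Lemma cone_gen_coeff_gt0 S p :
  cone_gen (coeff_gt0 S) p -> p = 0 \/ 0 < p@_m.
Proof.
move: p; apply: cone_gen_ind_gt0 => [p q|c p c_gt0].
  by rewrite mcoeffD; apply: addr_gt0.
by rewrite mem_filter mcoeffZ => /andP[pm _]; apply: mulr_gt0.
Qed.

Lemma cone_gen_coeff_lt0 S p :
  cone_gen (coeff_lt0 S) p -> p = 0 \/ p@_m < 0.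
Proof.
move: p; apply: cone_gen_ind_gt0 => [p q pm qm|c p c_gt0].
  by rewrite mcoeffD -oppr_gt0 opprD addr_gt0 ?oppr_gt0.
by rewrite mem_filter mcoeffZ => /andP[pm _]; rewrite pmulr_rlt0.
Qed.

Lemma fourier_motzkin_step_cone S :
  {in fourier_motzkin_step S, forall p, cone_gen S p /\ p@_m = 0}.
Proof.
move=> p /fourier_motzkin_stepP[[pS pm]|[u [v [uS vS ->]]]].
  by split=> //; apply: cone_gen_mem.
split; last exact: mcoeff_cancel_comb.
move: uS vS; rewrite !mem_filter => /andP[um uS] /andP[vm vS].
by apply/cone_genD; apply/cone_genZ/cone_gen_mem; rewrite ?oppr_ge0 ?ltW.
Qed.

(* If p = a + b + c is a sign decomposition with b@_m = - c@_m > 0, then b + c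
   is cancel_comb b c divided by b@_m. *)
Lemma cone_gen_fourier_motzkin_step S p :
  cone_gen (fourier_motzkin_step S) p <-> cone_gen S p /\ p@_m = 0.
Proof.
split=> [|[/cone_gen_sign_split[a [b [c [Sa Sb Sc ->]]]]]].
  move: p; apply: cone_gen_ind.
  - by split; [exact: cone_gen0|rewrite mcoeff0].
  - move=> p q [Sp pm] [Sq qm].
    by split; [exact: cone_genD|rewrite mcoeffD pm qm addr0].
  move=> c p c_ge0 /fourier_motzkin_step_cone[Sp pm].
  by split; [exact: cone_genZ|rewrite mcoeffZ pm mulr0].
rewrite !mcoeffD (cone_gen_coeff_eq0 Sa) add0r => /eqP.
rewrite addr_eq0 => /eqP bm; rewrite -addrA; apply: cone_genD.
  move: a Sa; apply: cone_gen_ind; [exact: cone_gen0|exact: cone_genD|].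
  move=> d q d_ge0 qS; apply/cone_genZ/cone_gen_mem => //.
  by rewrite mem_cat qS.
case: (cone_gen_coeff_gt0 Sb) => [b0|bm_gt0].
  case: (cone_gen_coeff_lt0 Sc) => [->|].
    by rewrite b0 addr0; apply: cone_gen0.
  by rewrite -oppr_gt0 -bm b0 mcoeff0 ltxx.
have -> : b + c = (b@_m)^-1 *: cancel_comb b c.
  by rewrite /cancel_comb -bm -scalerDr scalerA mulVf ?scale1r // gt_eqF.
apply: cone_genZ; first by rewrite invr_ge0 ltW.
apply: (cone_gen_cancel_comb _ Sb Sc) => u v uS vS; apply/cone_gen_mem.
by apply/fourier_motzkin_stepP; right; exists u, v.
Qed.

End FourierMotzkin.

Lemma proj_exists_elim n (S : seq {mpoly rat[n]}) (N : pred 'X_{1..n})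
    (r : seq 'X_{1..n}) :
  {in S, forall p, in_span (fun m => N m || (m \in r)) p} ->
  exists P, is_proj S N P.
Proof.
elim: r S => [|m r IH] S SN.
  exists S => p; split=> [Sp|[]//]; split=> //.
  apply: cone_gen_in_span Sp => q /SN.
  by apply: sub_all => m; rewrite orbF.
have [Nm|Nm] := boolP (N m).
  apply: IH => p /SN; apply: sub_all => m'; rewrite inE.
  by case: eqVneq => [->|//]; rewrite Nm.
have [|P hP] := IH (fourier_motzkin_step m S).
  move=> p /(fourier_motzkin_step_in_span SN); apply: sub_all => m' /=.
  by rewrite inE; case: eqVneq => //=; rewrite ?andbF ?andbT.
exists P => p; rewrite hP cone_gen_fourier_motzkin_step.
split=> [[[]]//|[Sp pN]]; do !split=> //.
by apply: memN_msupp_eq0; apply: contra Nm; apply: (allP pN).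
Qed.

Lemma proj_exists n (S : seq {mpoly rat[n]}) (N : pred 'X_{1..n}) :
  exists P, is_proj S N P.
Proof.
apply: (@proj_exists_elim n S N (flatten [seq msupp p | p <- S])) => p pS.
apply/allP => m mp; apply/orP; right; apply/flattenP.
by exists (msupp p) => //; apply: map_f.
Qed.

(** * Monomial orders *)

Section Dickson.
Variable n : nat.
Implicit Types (I : seq 'I_n) (Q : 'X_{1..n} -> Prop) (m : 'X_{1..n}).

Definition finite_basis I Q : Prop :=
  exists L : seq 'X_{1..n}, {in L, forall l, Q l} /\
    forall m, Q m -> exists2 l, l \in L & {in I, forall i, (l i <= m i)%N}.

Lemma finite_basis_nil Q : finite_basis [::] Q.
Proof.
have [[m Qm]|noQ] := pselect (exists m, Q m).
  exists [:: m]; split=> [l|m' _]; first by rewrite inE => /eqP ->.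
  by exists m; rewrite ?mem_head.
by exists [::]; split=> // m Qm; case: noQ; exists m.
Qed.

Lemma finite_basis_bounded i I Q :
  (forall b, finite_basis I (fun m => Q m /\ m i = b)) ->
  forall B, finite_basis (i :: I) (fun m => Q m /\ (m i < B)%N).
Proof.
move=> fiber; elim=> [|B [L [LQ Lmin]]].
  by exists [::]; split=> // m [_]; rewrite ltn0.
have [L' [L'Q L'min]] := fiber B; exists (L ++ L'); split=> [l|m [Qm]].
  rewrite mem_cat => /orP[/LQ[Ql lt_l]|/L'Q[Ql <-]] //.
  by split=> //; apply: leqW.
rewrite ltnS leq_eqVlt => /orP[/eqP miB|lt_mi].
  have [l lL' le_l] := L'min m (conj Qm miB).
  exists l => [|j]; first by rewrite mem_cat lL' orbT.
  rewrite inE => /orP[/eqP ->|/le_l //].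
  by have [_ ->] := L'Q l lL'; rewrite miB.
have [l lL le_l] := Lmin m (conj Qm lt_mi).
by exists l; rewrite // mem_cat lL.
Qed.

(* A basis L0 for the exponents in I also bounds the exponent of i at the m
   for which m i is at least that of every element of L0. *)
Lemma finite_basis_cons i I Q : finite_basis I Q ->
  (forall B, finite_basis (i :: I) (fun m => Q m /\ (m i < B)%N)) ->
  finite_basis (i :: I) Q.
Proof.
move=> [L0 [L0Q L0min]] bounded; pose B := \max_(l <- L0) l i.
have [L [LQ Lmin]] := bounded B; exists (L0 ++ L); split=> [l|m Qm].
  by rewrite mem_cat => /orP[/L0Q|/LQ[]].
have [lt_mB|le_Bm] := ltnP (m i) B.
  have [l lL le_l] := Lmin m (conj Qm lt_mB).
  by exists l; rewrite // mem_cat lL orbT.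
have [l lL0 le_l] := L0min m Qm; exists l; first by rewrite mem_cat lL0.
move=> j; rewrite inE => /orP[/eqP ->|/le_l //].
by apply: leq_trans le_Bm; rewrite /B (big_rem l) //= leq_maxl.
Qed.

Lemma finite_basis_exists I Q : finite_basis I Q.
Proof.
elim: I Q => [|i I IH] Q; first exact: finite_basis_nil.
exact/finite_basis_cons/finite_basis_bounded.
Qed.

Lemma dickson Q : exists L : seq 'X_{1..n}, {in L, forall l, Q l} /\
  forall m, Q m -> exists2 l, l \in L & (l <= m)%MM.
Proof.
have [L [LQ Lmin]] := finite_basis_exists (enum 'I_n) Q.
exists L; split=> // m /Lmin[l lL le_l]; exists l => //.
by apply/mnm_lepP => i; apply/le_l/mem_enum.
Qed.

End Dickson.

Lemma total_seq_min (T : eqType) (r : rel T) (s : seq T) :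
  transitive r -> total r -> s != [::] ->
  exists2 x, x \in s & {in s, forall y, r x y}.
Proof.
move=> r_trans r_total; rewrite -size_eq0 -(size_sort r) => s_neq0.
have := sort_sorted r_total s; have := mem_sort r s.
case: (sort r s) s_neq0 => // x s' _ s'E /(order_path_min r_trans)/allP min_x.
exists x => [|y]; first by rewrite -s'E mem_head.
rewrite -s'E inE => /orP[/eqP ->|/min_x //].
by have := r_total x x; rewrite orbb.
Qed.

Section MonomialOrder.
Variables (n : nat) (le : rel 'X_{1..n}) (le_mo : monomial_order le).
Implicit Types (p q g : {mpoly rat[n]}) (m : 'X_{1..n}).

Lemma mo_dvd m m' : (m' <= m)%MM -> le m' m.
Proof.
move=> /submK <-; rewrite -{1}[m'](add0m m').
exact/(mo_mul le_mo)/(mo_one le_mo).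
Qed.

Lemma mo_anti m m' : le m m' -> le m' m -> m = m'.
Proof. by move=> le_mm' le_m'm; apply: (mo_antisym le_mo); rewrite le_mm'. Qed.

Lemma mo_min (Q : 'X_{1..n} -> Prop) :
  (exists m, Q m) -> exists2 m, Q m & forall m', Q m' -> le m m'.
Proof.
move=> [m0 Qm0]; have [L [LQ Lmin]] := dickson Q.
have L_neq0 : L != [::] by have [l] := Lmin _ Qm0; case: (L).
have [m mL min_m] := total_seq_min (mo_trans le_mo) (mo_total le_mo) L_neq0.
exists m => [|m' /Lmin[l lL /mo_dvd le_l]]; first exact: LQ.
exact: (mo_trans le_mo) (min_m l lL) le_l.
Qed.

Definition mo_lt : rel 'X_{1..n} := fun m m' => (m != m') && le m m'.

Lemma mo_lt_wf : well_founded mo_lt.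
Proof.
move=> m; apply: contrapT => not_acc.
have [|m1 not_acc1 min_m1] := mo_min (Q := fun m => ~ Acc mo_lt m).
  by exists m.
apply: not_acc1; split=> m2 /andP[/eqP ne_m2 le_m2].
by apply: contrapT => /min_m1/(mo_anti le_m2).
Qed.

Lemma lead_mon_exists p : p != 0 -> exists m, lead_mon le p m.
Proof.
rewrite -msupp_eq0; case/(@total_seq_min _ (fun m m' => le m' m)).
- by move=> m1 m2 m3 le21 le13; apply: (mo_trans le_mo) le13 le21.
- by move=> m m'; apply: (mo_total le_mo).
by move=> m mp max_m; exists m.
Qed.

Lemma lead_mon_ind (K : {mpoly rat[n]} -> Prop) :
  K 0 ->
  (forall p m, lead_mon le p m ->
     (forall q, {in msupp q, forall m', mo_lt m' m} -> K q) -> K p) ->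
  forall p, K p.
Proof.
move=> K0 IH p; have [->//|/lead_mon_exists[m lead_m]] := eqVneq p 0.
elim/(well_founded_ind mo_lt_wf): m p lead_m => m IHm p lead_m.
apply: (IH p m lead_m) => q lt_qm.
have [->//|/lead_mon_exists[m' lead_m']] := eqVneq q 0.
by apply: (IHm m' _ q lead_m'); apply: lt_qm; case: lead_m'.
Qed.

Lemma lead_monX m : lead_mon le 'X_[m] m.
Proof.
split=> [|m']; rewrite msuppX inE // => /eqP ->; exact: (mo_refl le_mo).
Qed.

Lemma lead_monZ c p m : c != 0 -> lead_mon le p m -> lead_mon le (c *: p) m.
Proof.
move=> c_neq0 [mp max_m]; have eq_supp := perm_mem (msuppZ p c_neq0).
by split=> [|m']; rewrite eq_supp // => /max_m.
Qed.

Lemma lead_monMX p m k : lead_mon le p m -> lead_mon le (p * 'X_[k]) (k + m)%MM.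
Proof.
move=> [mp max_m]; split=> [|m']; rewrite (perm_mem (msuppMX _ _)).
  exact: map_f.
case/mapP => m1 /max_m le_m1 ->; rewrite ![(k + _)%MM]addmC.
exact: (mo_mul le_mo).
Qed.

Lemma lead_mon_cancel p u m : lead_mon le p m -> lead_mon le u m -> u@_m = 1 ->
  {in msupp (p - p@_m *: u), forall m', mo_lt m' m}.
Proof.
move=> [_ max_p] [_ max_u] um m' m'pu; apply/andP; split.
  apply: contraTneq m'pu => ->.
  by rewrite mcoeff_msupp mcoeffB mcoeffZ um mulr1 subrr eqxx.
have := msuppB_le m'pu; rewrite mem_cat => /orP[/max_p //|/msuppZ_le].
exact: max_u.
Qed.

End MonomialOrder.

(** * Groebner bases *)

Lemma partial_choice (T U : Type) (u0 : U) (A : T -> Prop)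
    (R : T -> U -> Prop) :
  (forall x, A x -> exists y, R x y) ->
  exists f, forall x, A x -> R x (f x).
Proof.
move=> AR; have /choice[f fP] : forall x, exists y, A x -> R x y.
  by move=> x; have [/AR[y]|] := pselect (A x); [exists y|exists u0].
by exists f.
Qed.

Section Groebner.
Variables (n : nat) (le : rel 'X_{1..n}).
Implicit Types (W : {set 'I_n}) (p q r g : {mpoly rat[n]}) (m : 'X_{1..n}).
Implicit Types (Z P G S : seq {mpoly rat[n]}).

Definition standard_mon G : pred 'X_{1..n} := fun m =>
  `[< forall g m', g \in G -> lead_mon le g m' -> ~~ (m' <= m)%MM >].

Lemma standard_monPn G m :
  ~~ standard_mon G m ->
  exists g m', [/\ g \in G, lead_mon le g m' & (m' <= m)%MM].
Proof.
move=> /asboolPn not_std; apply: contrapT => no_g.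
apply: not_std => g m' gG lead_g; apply/negP => dvd_m.
by apply: no_g; exists g, m'.
Qed.

Lemma normal_formP W G p r : normal_form le W G p r <->
  ideal_gen W G (p - r) /\ in_span (standard_mon G) r.
Proof.
split=> -[Gpr std_r]; split=> //.
  by apply/allP => m mr; apply/asboolP => g m'; apply: std_r.
by move=> m g m' mr; have /asboolP := allP std_r m mr; apply.
Qed.

Lemma normal_form_id W G r :
  in_span (standard_mon G) r -> normal_form le W G r r.
Proof.
move=> std_r; apply/normal_formP; rewrite subrr; split=> //.
exact: ideal_gen0.
Qed.

Lemma normal_formD W G p q r s : normal_form le W G p r ->
  normal_form le W G q s -> normal_form le W G (p + q) (r + s).
Proof.
move=> /normal_formP[Gpr std_r] /normal_formP[Gqs std_s]; apply/normal_formP.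
split; last exact: in_spanD.
by rewrite opprD addrACA; apply: ideal_genD.
Qed.

Lemma normal_formZ W G c p r :
  normal_form le W G p r -> normal_form le W G (c *: p) (c *: r).
Proof.
move=> /normal_formP[Gpr std_r]; apply/normal_formP.
by split; [rewrite -scalerBr; apply: ideal_genZ|apply: in_spanZ].
Qed.

Lemma normal_form_over W G p r : {in G, forall g, poly_over W g} ->
  poly_over W p -> normal_form le W G p r -> poly_over W r.
Proof.
move=> GW pW [Gpr _]; rewrite -[r](subKr p); apply: poly_overB => //.
exact: ideal_gen_over Gpr.
Qed.

Hypothesis le_mo : monomial_order le.

Lemma standard_eq0 G r :
  (forall m, lead_mon le r m ->
     exists g m', [/\ g \in G, lead_mon le g m' & (m' <= m)%MM]) ->
  in_span (standard_mon G) r -> r = 0.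
Proof.
move=> lead_G /allP std_r.
have [//|/(lead_mon_exists le_mo)[m lead_m]] := eqVneq r 0.
have [g [m' [gG lead_g dvd_m]]] := lead_G m lead_m.
by have /asboolP/(_ g m' gG lead_g)/negP := std_r m (proj1 lead_m).
Qed.

Lemma normal_form_unique W G Z p r s : groebner le W G Z ->
  normal_form le W G p r -> normal_form le W G p s -> r = s.
Proof.
move=> gbG /normal_formP[Gpr std_r] /normal_formP[Gps std_s].
apply/eqP; rewrite -subr_eq0; apply/eqP.
apply: (@standard_eq0 G) => // [m|]; last exact: in_spanB.
apply: (proj2 gbG); apply/(proj1 gbG).
by have -> : r - s = (p - s) - (p - r) by [ring]; apply: ideal_genB.
Qed.

Lemma monomial_reduction W G m :
  {in G, forall g, poly_over W g} -> mon_over W m ->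
  exists u r, [/\ poly_over W u, lead_mon le u m, u@_m = 1
                & normal_form le W G u r].
Proof.
move=> GW mW; have [std_m|] := boolP (standard_mon G m).
  exists 'X_[m], 'X_[m]; rewrite poly_overX mcoeffX eqxx; split=> //.
    exact: lead_monX.
  by apply: normal_form_id; rewrite in_spanX.
move=> /standard_monPn[g [m' [gG lead_g dvd_m]]].
have gm'_neq0 : g@_m' != 0 by rewrite -mcoeff_msupp; case: lead_g.
have uW : poly_over W 'X_[m - m'].
  by rewrite poly_overX; apply: mon_over_le mW; apply: lem_subr.
exists ((g@_m')^-1 *: (g * 'X_[m - m'])), 0; split.
- by apply/poly_overZ/poly_overM => //; apply: GW.
- rewrite -{2}(submK dvd_m).
  by apply: lead_monZ; [rewrite invr_eq0|apply: lead_monMX].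
- by rewrite mcoeffZ -{1}(submK dvd_m) mcoeffMX mulVf.
apply/normal_formP; rewrite subr0; split; last exact: in_span0.
by apply: ideal_genZ; rewrite mulrC; apply/ideal_genM/ideal_gen_mem.
Qed.

Lemma normal_form_exists W G p :
  {in G, forall g, poly_over W g} -> poly_over W p ->
  exists r, normal_form le W G p r.
Proof.
move=> GW; elim/(lead_mon_ind le_mo): p => [_|p m lead_p IH pW].
  by exists 0; apply/normal_form_id/in_span0.
have mW : mon_over W m by apply: (poly_overP _ _ pW); case: lead_p.
have [u [r [uW lead_u um nf_u]]] := monomial_reduction GW mW.
have [||s nf_s] := IH (p - p@_m *: u).
- exact: lead_mon_cancel.
- exact/poly_overB/poly_overZ.
exists (s + p@_m *: r).
by have := normal_formD nf_s (normal_formZ p@_m nf_u); rewrite subrK.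
Qed.

Lemma groebner_of_lead W G Z :
  {in Z, forall z, poly_over W z} -> {in G, forall g, ideal_gen W Z g} ->
  (forall p m, ideal_gen W Z p -> lead_mon le p m ->
     exists g m', [/\ g \in G, lead_mon le g m' & (m' <= m)%MM]) ->
  groebner le W G Z.
Proof.
move=> ZW GZ lead_G; split=> // p; split=> [|Zp]; first exact: ideal_gen_sub.
have GW g : g \in G -> poly_over W g by move=> /GZ; apply: ideal_gen_over.
have pW := ideal_gen_over ZW Zp.
have [r /normal_formP[Gpr std_r]] := normal_form_exists GW pW.
suff r0 : r = 0 by rewrite r0 subr0 in Gpr.
apply: (standard_eq0 _ std_r) => m; apply: lead_G.
by rewrite -[r](subKr p); apply: ideal_genB => //; apply: ideal_gen_sub Gpr.
Qed.

Lemma groebner_exists W Z :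
  {in Z, forall z, poly_over W z} -> exists G, groebner le W G Z.
Proof.
move=> ZW.
pose has_lead m p := ideal_gen W Z p /\ lead_mon le p m.
have [L [L_lead Lmin]] := dickson (fun m => exists p, has_lead m p).
have [f fP] := partial_choice 0 (fun m (ex_p : exists p, has_lead m p) => ex_p).
exists [seq f m | m <- L]; apply: groebner_of_lead => // [g|p m Zp lead_p].
  by case/mapP => m /L_lead/fP[Zf _] ->.
have [|l lL dvd_m] := Lmin m; first by exists p.
by exists (f l), l; split=> //; [apply: map_f|have [] := fP l (L_lead l lL)].
Qed.

Lemma groebner_over W G Z : {in Z, forall z, poly_over W z} ->
  groebner le W G Z -> {in G, forall g, poly_over W g}.
Proof.
by move=> ZW [GZ _] g gG; apply: (ideal_gen_over ZW); apply/GZ/ideal_gen_mem.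
Qed.

Definition normal_forms W G P S : Prop :=
  forall s, s \in S <-> exists2 p, p \in P & normal_form le W G p s.

Lemma normal_forms_exist W G Z P : zp_over W (Z, P) -> groebner le W G Z ->
  exists S, normal_forms W G P S.
Proof.
move=> [/= ZW PW] gbG; have GW := groebner_over ZW gbG.
have [nf nfP] := partial_choice 0 (fun p => @normal_form_exists W G p GW).
exists [seq nf p | p <- P] => s; split=> [/mapP[p pP ->]|[p pP nf_s]].
  by exists p => //; apply/nfP/PW.
apply/mapP; exists p => //.
exact: normal_form_unique gbG nf_s (nfP p (PW p pP)).
Qed.

Lemma alg_cone_normal_forms W G Z P S : zp_over W (Z, P) ->
  groebner le W G Z -> normal_forms W G P S ->
  forall p, alg_cone W (G, S) p <-> alg_cone W (Z, P) p.
Proof.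
move=> [/= ZW PW] gbG nfS p; have [GZ _] := gbG.
split; move: p; apply: alg_cone_sub => //= p.
- by move=> gG; apply/GZ/ideal_gen_mem.
- move=> /nfS[q qP [Gqp _]]; rewrite -[p](subKr q).
  apply: alg_coneD; first exact/alg_cone_cone/cone_gen_mem.
  exact/alg_cone_ideal/ideal_genN/GZ.
- by move=> zZ; apply/GZ/ideal_gen_mem.
move=> pP; have [s nf_s] := normal_form_exists (groebner_over ZW gbG) (PW p pP).
rewrite -[p](subrK s); apply: alg_coneD.
  by apply: alg_cone_ideal; case: nf_s.
by apply/alg_cone_cone/cone_gen_mem/nfS; exists p.
Qed.

Lemma reduced_exists W ZP : zp_over W ZP ->
  exists2 ZP', reduced le W ZP' &
    forall p, alg_cone W ZP' p <-> alg_cone W ZP p.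
Proof.
case: ZP => Z P ZPW; have [G gbG] := groebner_exists (proj1 ZPW).
have [S nfS] := normal_forms_exist ZPW gbG; have [GZ lead_G] := gbG.
exists (G, S); last exact: alg_cone_normal_forms.
split=> [|s /nfS[p _ /normal_formP[_ std_s]]]; last exact: normal_form_id.
by split=> // p m /GZ; apply: lead_G.
Qed.

End Groebner.

(** * Elimination and projection *)

Section MonPart.
Variable n : nat.
Implicit Types (W : {set 'I_n}) (m : 'X_{1..n}).

Lemma mon_partD W m m' :
  mon_part W (m + m')%MM = (mon_part W m + mon_part W m')%MM.
Proof. by apply/mnmP => i; rewrite mnmDE !mnmE; case: ifP. Qed.

Lemma mon_part0 W : mon_part W 0%MM = 0%MM :> 'X_{1..n}.
Proof. by apply/mnmP => i; rewrite mnmE !mnm0E if_same. Qed.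

Lemma mon_part_inj W m m' : mon_part W m = mon_part W m' ->
  mon_part (~: W) m = mon_part (~: W) m' -> m = m'.
Proof.
move=> /mnmP eqW /mnmP eqCW; apply/mnmP => i.
by have := eqW i; have := eqCW i; rewrite !mnmE inE; case: (i \in W).
Qed.

Lemma mon_part_over W m : mon_over W m -> mon_part W m = m.
Proof.
by move=> /mon_overP mW; apply/mnmP => i; rewrite mnmE; case: ifPn => // /mW.
Qed.

Lemma mon_partC_eq0 W m : (mon_part (~: W) m == 0%MM) = mon_over W m.
Proof.
apply/eqP/mon_overP => [/mnmP m0 i iW|mW].
  by have := m0 i; rewrite mnmE mnm0E inE iW.
by apply/mnmP => i; rewrite mnmE mnm0E inE; case: ifP => // /mW.
Qed.

End MonPart.

Section Elimination.
Variables (n : nat) (le : rel 'X_{1..n}) (X : {set 'I_n}).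
Hypothesis le_mo : monomial_order le.
Implicit Types (m : 'X_{1..n}) (p q r g : {mpoly rat[n]}).
Implicit Types (G P S : seq {mpoly rat[n]}) (ZP : zp_pair n).

Lemma elim_order_monomial_order : monomial_order (elim_order le X).
Proof.
have le_eq := mo_anti le_mo; rewrite /elim_order; split.
- by move=> m; rewrite eqxx (mo_refl le_mo).
- move=> m m' /andP[]; rewrite [mon_part _ m' == _]eq_sym.
  case: eqP => eqC le_mm' le_m'm.
    by apply: mon_part_inj eqC; apply: le_eq.
  by case: eqC; apply: le_eq.
- move=> y x z; case: eqP => [->|neq_xy]; case: eqP => [eq_yz|_] le_xy le_yz.
  + exact: (mo_trans le_mo) le_xy le_yz.
  + exact: le_yz.
  + by rewrite -eq_yz; case: eqP.
  case: eqP => [eq_xz|_]; last exact: (mo_trans le_mo) le_xy le_yz.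
  by case: neq_xy; apply: le_eq => //; rewrite eq_xz.
- move=> x y; rewrite [mon_part _ y == _]eq_sym.
  by case: eqP => _; apply: mo_total.
- by move=> m; rewrite !mon_part0; case: eqP => _; apply: mo_one.
- move=> m1 m2 m; rewrite !mon_partD eqm_add2r.
  by case: eqP => _; apply: mo_mul.
Qed.

Lemma elim_orderE m m' : mon_over X m -> mon_over X m' ->
  elim_order le X m m' = le m m'.
Proof.
move=> mX m'X; rewrite /elim_order (mon_part_over mX) (mon_part_over m'X).
by move: mX m'X; rewrite -!mon_partC_eq0 => /eqP -> /eqP ->; rewrite eqxx.
Qed.

Lemma elim_order_over m m' :
  elim_order le X m' m -> mon_over X m -> mon_over X m'.
Proof.
rewrite /elim_order -!mon_partC_eq0 => le_m'm /eqP m0; move: le_m'm; rewrite m0.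
case: eqP => // neq0 le0; case: neq0.
exact: (mo_anti le_mo le0 (mo_one le_mo _)).
Qed.

Lemma lead_elim_over g m :
  lead_mon (elim_order le X) g m -> mon_over X m -> poly_over X g.
Proof.
by move=> [_ max_m] mX; apply/poly_overP => m' /max_m/elim_order_over; apply.
Qed.

Lemma lead_elimE g m : poly_over X g ->
  lead_mon (elim_order le X) g m <-> lead_mon le g m.
Proof.
move=> /poly_overP gX; split=> -[mg max_m]; split=> // m' m'g.
  by rewrite -elim_orderE ?gX // max_m.
by rewrite elim_orderE ?gX // max_m.
Qed.

Definition elim_basis G := [seq g <- G | poly_over X g].

Lemma mem_elim_basis G g : (g \in elim_basis G) = poly_over X g && (g \in G).
Proof. exact: mem_filter. Qed.

Lemma elim_basis_over G : {in elim_basis G, forall g, poly_over X g}.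
Proof. by move=> g; rewrite mem_elim_basis => /andP[]. Qed.

Lemma standard_mon_elim G m : mon_over X m ->
  standard_mon (elim_order le X) G m = standard_mon le (elim_basis G) m.
Proof.
move=> mX; apply: asbool_equiv_eq; split=> std_m g m'.
  rewrite mem_elim_basis => /andP[gX gG] /(lead_elimE _ gX); exact: std_m.
move=> gG lead_g; apply/negP => dvd_m.
have gX := lead_elim_over lead_g (mon_over_le dvd_m mX).
have gG' : g \in elim_basis G by rewrite mem_elim_basis gX.
by have /negP := std_m g m' gG' (proj1 (lead_elimE _ gX) lead_g).
Qed.

Lemma in_span_standard_mon_elim G p : poly_over X p ->
  in_span (standard_mon (elim_order le X) G) p =
  in_span (standard_mon le (elim_basis G)) p.
Proof.
by move=> /poly_overP pX; apply: eq_in_all => m /pX; apply: standard_mon_elim.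
Qed.

Lemma normal_forms_in_span (le' : rel 'X_{1..n}) W G P S :
  normal_forms le' W G P S ->
  forall p, cone_gen S p -> in_span (standard_mon le' G) p.
Proof.
by move=> nfS; apply: cone_gen_in_span => s /nfS[q _ /normal_formP[]].
Qed.

Variables (V : {set 'I_n}) (X_sub_V : X \subset V).

Lemma ideal_gen_elim_basis G p :
  ideal_gen X (elim_basis G) p -> ideal_gen V G p.
Proof.
apply: ideal_gen_sub => // g; rewrite mem_elim_basis => /andP[_].
exact: ideal_gen_mem.
Qed.

Lemma groebner_elim_basis G Z : groebner (elim_order le X) V G Z ->
  groebner le X (elim_basis G) (elim_basis G).
Proof.
move=> [GZ lead_G]; split=> // p m Gp lead_p.
have pX := ideal_gen_over (elim_basis_over (G := G)) Gp.
have [||g [m' [gG lead_g dvd_m]]] := lead_G p m.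
- exact/GZ/ideal_gen_elim_basis.
- exact/lead_elimE.
have gX : poly_over X g.
  apply: lead_elim_over lead_g (mon_over_le dvd_m _).
  by apply: (poly_overP _ _ pX); case: lead_p.
by exists g, m'; rewrite mem_elim_basis gX; split=> //; apply/lead_elimE.
Qed.

Lemma normal_form_elim_basis G p r : poly_over X p ->
  normal_form le X (elim_basis G) p r -> normal_form (elim_order le X) V G p r.
Proof.
move=> pX nf_r; have rX := normal_form_over (elim_basis_over (G := G)) pX nf_r.
have [Gpr std_r] := proj1 (normal_formP _ _ _ _ _) nf_r; apply/normal_formP.
rewrite in_span_standard_mon_elim //; split=> //.
exact: ideal_gen_elim_basis.
Qed.

Lemma project_over ZP ZP' : project le V X ZP ZP' -> zp_over X ZP'.
Proof.
move=> [G [S [_ _ ZE projP]]]; split=> p.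
  by rewrite ZE; apply: elim_basis_over.
by move=> /cone_gen_mem/projP[].
Qed.

Lemma project_reduced ZP ZP' : project le V X ZP ZP' -> reduced le X ZP'.
Proof.
case: ZP' => Z' P' [G [S [/= gbG nfS ZE projP]]].
rewrite ZE -/(elim_basis G); split=> [|p /cone_gen_mem/projP[Sp pX]].
  exact: groebner_elim_basis gbG.
apply: normal_form_id; rewrite -in_span_standard_mon_elim //.
exact: (normal_forms_in_span nfS Sp).
Qed.

(* If p in Q[X] is a + b with a in <G> and b in cone(S), then b is the normal
   form of p modulo G, which only depends on the elements of G in Q[X]. *)
Lemma project_cone ZP ZP' : zp_over V ZP -> project le V X ZP ZP' ->
  forall p, alg_cone X ZP' p <-> alg_cone V ZP p /\ poly_over X p.
Proof.
case: ZP ZP' => [Z P] [Z' P'] ZPV /[dup] prj [G [S [/= gbG nfS ZE projP]]] p.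
have elim_mo := elim_order_monomial_order.
have coneE := alg_cone_normal_forms elim_mo ZPV gbG nfS.
split=> [Z'p|[/coneE[a [b [/= Ga Sb pE]]] pX]].
  split; last exact: alg_cone_over (project_over prj) _ Z'p.
  apply/coneE; move: p Z'p; apply: alg_cone_sub => // p /=; rewrite ?ZE.
    rewrite mem_elim_basis => /andP[_]; exact: ideal_gen_mem.
  by move=> /cone_gen_mem/projP[Sp _]; apply: alg_cone_cone.
have [r nf_r] := normal_form_exists le_mo (elim_basis_over (G := G)) pX.
have rX := normal_form_over (elim_basis_over (G := G)) pX nf_r.
have br : b = r.
  apply: (normal_form_unique elim_mo gbG _ (normal_form_elim_basis pX nf_r)).
  apply/normal_formP; rewrite pE addrK; split=> //.
  exact: (normal_forms_in_span nfS Sb).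
exists (p - b), b; split=> /=; last by rewrite subrK.
  by rewrite br ZE; case: nf_r.
by apply/projP; split; rewrite // br.
Qed.

Lemma project_exists ZP : zp_over V ZP -> exists ZP', project le V X ZP ZP'.
Proof.
case: ZP => Z P ZPV; have elim_mo := elim_order_monomial_order.
have [G gbG] := groebner_exists elim_mo (proj1 ZPV).
have [S nfS] := normal_forms_exist elim_mo ZPV gbG.
have [P' projP] := proj_exists S (mon_over X).
by exists (elim_basis G, P'), G, S.
Qed.

End Elimination.

(** * Intersection *)

Section Intersection.
Variables (n : nat) (le : rel 'X_{1..n}) (X : {set 'I_n}) (t : 'I_n).
Hypotheses (le_mo : monomial_order le) (t_fresh : t \notin X).
Implicit Types (p q : {mpoly rat[n]}) (S : seq {mpoly rat[n]}) (ZP : zp_pair n).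

Definition blend S1 S2 := scale_seq 'X_t S1 ++ scale_seq (1 - 'X_t) S2.

Definition blend_pair ZP1 ZP2 : zp_pair n :=
  (blend ZP1.1 ZP2.1, blend ZP1.2 ZP2.2).

Lemma blend_over S1 S2 :
  {in S1, forall p, poly_over X p} -> {in S2, forall p, poly_over X p} ->
  {in blend S1 S2, forall p, poly_over (t |: X) p}.
Proof.
have XtV : poly_over (t |: X) 'X_t by rewrite poly_overXU ?setU11.
have X_sub_V : X \subset t |: X by apply: subsetUr.
move=> S1X S2X p; rewrite mem_cat => /orP[] /mapP[s sS ->];
  apply: poly_overM => //.
- exact: poly_overS (S1X s sS).
- exact/poly_overB/XtV/poly_over1.
- exact: poly_overS (S2X s sS).
Qed.

Lemma blend_pair_over ZP1 ZP2 : zp_over X ZP1 -> zp_over X ZP2 ->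
  zp_over (t |: X) (blend_pair ZP1 ZP2).
Proof. by move=> [Z1X P1X] [Z2X P2X]; split; apply: blend_over. Qed.

Definition t_value (c : rat) : n.-tuple {mpoly rat[n]} :=
  [tuple if i == t then c%:MP else 'X_i | i < n].

Lemma comp_t_value_id c p : poly_over X p -> p \mPo t_value c = p.
Proof.
apply: comp_mpoly_id_over => i iX; rewrite tnth_mktuple.
by case: eqP iX t_fresh => // -> ->.
Qed.

Lemma comp_t_value_Xt c : 'X_t \mPo t_value c = c%:MP.
Proof. by rewrite comp_mpolyXU -tnth_nth tnth_mktuple eqxx. Qed.

Lemma comp_t_value_over c p :
  poly_over (t |: X) p -> poly_over X (p \mPo t_value c).
Proof.
apply: comp_mpoly_over => i; rewrite in_setU1 tnth_mktuple.
by case: eqP => [_ _|_ /= iX]; [apply: poly_overC|apply: poly_overXU].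
Qed.

Lemma comp_t_value_blend (b : bool) S1 S2 p :
  {in S1, forall s, poly_over X s} -> {in S2, forall s, poly_over X s} ->
  p \in blend S1 S2 ->
  p \mPo t_value b%:R = 0 \/ p \mPo t_value b%:R \in if b then S1 else S2.
Proof.
move=> S1X S2X; rewrite mem_cat => /orP[] /mapP[s sS ->]; rewrite rmorphM /=.
  rewrite comp_t_value_Xt comp_t_value_id ?S1X // mul_mpolyC.
  by case: b; rewrite ?scale1r ?scale0r; [right|left].
rewrite rmorphB rmorph1 /= comp_t_value_Xt comp_t_value_id ?S2X //.
case: b; rewrite ?mpolyC1 ?mpolyC0; first by left; rewrite subrr mul0r.
by right; rewrite subr0 mul1r.
Qed.

Lemma alg_cone_blend_pair (b : bool) ZP1 ZP2 p :
  zp_over X ZP1 -> zp_over X ZP2 ->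
  alg_cone (t |: X) (blend_pair ZP1 ZP2) p -> poly_over X p ->
  alg_cone X (if b then ZP1 else ZP2) p.
Proof.
move=> [Z1X P1X] [Z2X P2X] blend_p pX; rewrite -(comp_t_value_id b%:R pX).
move: p blend_p {pX}; apply: alg_cone_linear => [q z qV|q] /=.
  move=> /(comp_t_value_blend b Z1X Z2X) z_val; rewrite rmorphM /=.
  apply: ideal_genM; first exact: comp_t_value_over.
  case: z_val => [->|]; first exact: ideal_gen0.
  by case: (b) => ?; apply: ideal_gen_mem.
case/(comp_t_value_blend b P1X P2X) => [->|]; first exact: cone_gen0.
by case: (b) => ?; apply: cone_gen_mem.
Qed.

Lemma alg_cone_scale (W : {set 'I_n}) (f : {mpoly rat[n]}) ZP ZP' :
  X \subset W ->
  {in ZP.1, forall z, f * z \in ZP'.1} ->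
  {in ZP.2, forall p, f * p \in ZP'.2} ->
  forall p, alg_cone X ZP p -> alg_cone W ZP' (f * p).
Proof.
move=> sXW ZZ' PP'.
apply: (alg_cone_linear (phi := f \*o idfun)) => [q z qX|p] /=.
  move=> /ZZ' fz; rewrite mulrCA; apply: ideal_genM; last exact: ideal_gen_mem.
  exact: poly_overS qX.
by move=> /PP'; apply: cone_gen_mem.
Qed.

Lemma intersect_cone ZP1 ZP2 ZP' : zp_over X ZP1 -> zp_over X ZP2 ->
  intersect le X t ZP1 ZP2 ZP' ->
  forall p, alg_cone X ZP' p <-> alg_cone X ZP1 p /\ alg_cone X ZP2 p.
Proof.
move=> ZP1X ZP2X isect p; have X_sub_V : X \subset t |: X by apply: subsetUr.
rewrite (project_cone le_mo X_sub_V (blend_pair_over ZP1X ZP2X) isect).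
split=> [[blend_p pX]|[ZP1p ZP2p]].
  split; [exact: (alg_cone_blend_pair true ZP1X ZP2X blend_p)|].
  exact: (alg_cone_blend_pair false ZP1X ZP2X blend_p).
split; last exact: alg_cone_over ZP1p.
have -> : p = 'X_t * p + (1 - 'X_t) * p by ring.
by apply: alg_coneD; [apply: alg_cone_scale ZP1p|apply: alg_cone_scale ZP2p];
  rewrite // => s sZP; rewrite mem_cat map_f ?orbT.
Qed.

Lemma intersect_exists ZP1 ZP2 : zp_over X ZP1 -> zp_over X ZP2 ->
  exists ZP', intersect le X t ZP1 ZP2 ZP'.
Proof. by move=> ZP1X ZP2X; apply/project_exists/blend_pair_over. Qed.

Lemma intersect_reduced ZP1 ZP2 ZP' :
  intersect le X t ZP1 ZP2 ZP' -> reduced le X ZP'.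
Proof. exact/project_reduced/subsetUr. Qed.

End Intersection.

(** * Regular cones *)

Section RegularCones.
Variables (n : nat) (Y : {set 'I_n}).
Implicit Types (p q : {mpoly rat[n]}) (C : {mpoly rat[n]} -> Prop).
Implicit Types (S : seq {mpoly rat[n]}) (ZP : zp_pair n).

Lemma is_cone_scale C c p : is_cone Y C -> 0 < c -> C (c *: p) <-> C p.
Proof.
move=> [_ _ _ CZ] c_gt0; split=> [/(CZ c^-1)|]; last exact/CZ/ltW.
by rewrite scalerA mulVf ?gt_eqF // scale1r; apply; rewrite invr_ge0 ltW.
Qed.

Definition restrict_vars p : {mpoly rat[n]} :=
  p \mPo [tuple if i \in Y then 'X_i else 0 | i < n].

Lemma restrict_vars_over p : poly_over Y (restrict_vars p).
Proof.
apply: (comp_mpoly_over _ (poly_overT p)) => i _; rewrite tnth_mktuple.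
by case: ifP => [iY|_]; [apply: poly_overXU|apply: poly_over0].
Qed.

Lemma restrict_vars_id p : poly_over Y p -> restrict_vars p = p.
Proof. by apply: comp_mpoly_id_over => i iY; rewrite tnth_mktuple iY. Qed.

Lemma regular_cone_restrict_vars C : regular_cone Y C ->
  regular_cone setT (fun p => C (restrict_vars p)).
Proof.
move=> [[_ C0 CD CZ] C1 [_ units0 unitsD unitsM]].
have restrict0 : restrict_vars 0 = 0 := comp_mpoly0 _.
have restrictN : {morph restrict_vars : p / - p} := comp_mpolyN _.
have restrictD : {morph restrict_vars : p q / p + q} := comp_mpolyD _.
have restrictM : {morph restrict_vars : p q / p * q} := rmorphM (comp_mpoly _).
have restrictZ c : {morph restrict_vars : p / c *: p}.
  by move=> p; apply: comp_mpolyZ.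
split; last 1 first.
- split=> [p _||p q|p q _]; rewrite ?restrictN ?restrictD ?restrictM.
  + exact: poly_overT.
  + by rewrite restrict0.
  + exact: unitsD.
  + exact/unitsM/restrict_vars_over.
- split=> [p _||p q|c p c_ge0]; rewrite ?restrict0 ?restrictD ?restrictZ //.
  + exact: poly_overT.
  + exact: CD.
  + exact: CZ.
by rewrite restrict_vars_id ?poly_over1.
Qed.

Lemma alg_cone_sub_regular_cone C ZP : regular_cone Y C ->
  {in ZP.1, forall z, C z /\ C (- z)} -> {in ZP.2, forall p, C p} ->
  forall p, alg_cone Y ZP p -> C p.
Proof.
move=> [[_ _ CD CZ] _ [_ units0 unitsD unitsM]] CZ1 CP.
apply: alg_cone_ind => //.
  move=> p Zp; suff [] : C p /\ C (- p) by [].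
  by move: p Zp; apply: ideal_gen_ind => // p z pY /CZ1; apply: unitsM.
by move=> c p c_ge0 /CP; apply: CZ.
Qed.

Lemma alg_cone_regular ZP : zp_over Y ZP -> alg_cone Y ZP 1 ->
  (forall p, p \in ZP.2 -> alg_cone Y ZP (- p) -> ideal_gen Y ZP.1 p) ->
  regular_cone Y (alg_cone Y ZP).
Proof.
move=> ZPY ZP1 /alg_cone_units unitsP; split=> //; split.
- exact: alg_cone_over.
- exact: alg_cone0.
- exact: alg_coneD.
- exact: alg_coneZ.
- by move=> p [/(alg_cone_over ZPY)].
- exact/unitsP/ideal_gen0.
- by move=> p q /unitsP Zp /unitsP Zq; apply/unitsP/ideal_genD.
- by move=> p q pY /unitsP Zq; apply/unitsP/ideal_genM.
Qed.

Definition regular_hull S p : Prop :=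
  forall C, regular_cone Y C -> {in S, forall q, C q} -> C p.

(* The generators whose opposites are forced into every regular cone containing
   S span the ideal of additive units of the hull. *)
Definition regular_hull_pair S : zp_pair n :=
  ([seq p <- 1 :: S | `[< regular_hull S (- p) >]], 1 :: S).

Lemma regular_hull_pair_over S :
  {in S, forall p, poly_over Y p} -> zp_over Y (regular_hull_pair S).
Proof.
move=> SY; have over1S : {in 1 :: S, forall p, poly_over Y p}.
  by move=> p; rewrite inE => /orP[/eqP ->|/SY //]; apply: poly_over1.
by split=> // p; rewrite mem_filter => /andP[_ /over1S].
Qed.

Lemma alg_cone_regular_hull_pair S p :
  alg_cone Y (regular_hull_pair S) p -> regular_hull S p.
Proof.
move=> hull_p C C_reg SC; have [_ C1 _] := C_reg.
have C1S q : q \in 1 :: S -> C q by rewrite inE => /orP[/eqP ->|/SC].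
apply: alg_cone_sub_regular_cone hull_p => // z.
by rewrite mem_filter => /andP[/asboolP hullN /C1S]; split=> //; apply: hullN.
Qed.

Lemma least_regular_cone_exists S : {in S, forall p, poly_over Y p} ->
  exists2 ZP, zp_over Y ZP & least_regular_cone Y S (alg_cone Y ZP).
Proof.
move=> SY; exists (regular_hull_pair S); first exact: regular_hull_pair_over.
split=> [|p pS|C C_reg SC p /alg_cone_regular_hull_pair]; last exact.
  apply: alg_cone_regular; first exact: regular_hull_pair_over.
    exact/alg_cone_cone/cone_gen_mem/mem_head.
  move=> p pP /alg_cone_regular_hull_pair hullN; apply: ideal_gen_mem.
  by rewrite mem_filter pP andbT; apply/asboolP.
by apply/alg_cone_cone/cone_gen_mem; rewrite inE pS orbT.
Qed.

End RegularCones.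

(** * Models of LRR *)

Section RationalEmbedding.
Variable R : comNzRingType.
Variable natr_inv : forall k : nat, {x : R | x *+ k.+1 = 1}.

(* ratr requires R to be a unit ring. *)
Definition rat_emb (q : rat) : R :=
  (numq q)%:~R * sval (natr_inv (absz (denq q)).-1).

Lemma natr_inv_denq q :
  sval (natr_inv (absz (denq q)).-1) * (denq q)%:~R = 1.
Proof.
case: (denqP q) => d -> /=.
by rewrite -pmulrn mulr_natr (svalP (natr_inv d)).
Qed.

Lemma rat_emb_mul_denq q : rat_emb q * (denq q)%:~R = (numq q)%:~R.
Proof. by rewrite -mulrA natr_inv_denq mulr1. Qed.

Lemma mulr_denq_inj q (x y : R) : x * (denq q)%:~R = y * (denq q)%:~R -> x = y.
Proof.
move=> eq_xy; rewrite -[x]mulr1 -[y]mulr1 -(natr_inv_denq q).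
by rewrite mulrCA eq_xy mulrCA.
Qed.

Lemma rat_emb_is_zmod_morphism : zmod_morphism rat_emb.
Proof.
have regroup (S : comNzRingType) (a b c d e : S) :
    (a - b) * c * d * e = (a * d) * c * e - (b * e) * c * d by ring.
move=> p q; apply: (@mulr_denq_inj (p - q)).
apply: (@mulr_denq_inj p); apply: (@mulr_denq_inj q).
rewrite rat_emb_mul_denq regroup !rat_emb_mul_denq -!intrM -intrB.
congr (_ %:~R).
by apply: (@intr_inj rat); rewrite !(intrM, intrB) !numqE regroup.
Qed.

Lemma rat_emb_is_monoid_morphism : monoid_morphism rat_emb.
Proof.
split; first by apply: (@mulr_denq_inj 1); rewrite rat_emb_mul_denq mul1r.
have regroup (S : comNzRingType) (a b c d e : S) :
    a * b * c * d * e = (a * d) * (b * e) * c by ring.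
move=> p q; apply: (@mulr_denq_inj (p * q)).
apply: (@mulr_denq_inj p); apply: (@mulr_denq_inj q).
rewrite rat_emb_mul_denq regroup !rat_emb_mul_denq -!intrM; congr (_ %:~R).
by apply: (@intr_inj rat); rewrite !intrM !numqE regroup.
Qed.

HB.instance Definition _ :=
  GRing.isZmodMorphism.Build rat R rat_emb rat_emb_is_zmod_morphism.
HB.instance Definition _ :=
  GRing.isMonoidMorphism.Build rat R rat_emb rat_emb_is_monoid_morphism.

End RationalEmbedding.

Section LRRTheory.
Variables (R : comNzRingType) (le : R -> R -> Prop) (le_LRR : LRR le).
Implicit Types x y : R.

Definition LRR_natr_inv (k : nat) : {x : R | x *+ k.+1 = 1} :=
  cid (LRR_div le_LRR (ltn0Sn k)).

Local Notation emb := (rat_emb LRR_natr_inv).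

Lemma LRR_subr_ge0 x y : le 0 (y - x) <-> le x y.
Proof.
split=> [/(LRR_add le_LRR x)|/(LRR_add le_LRR (- x))]; last by rewrite subrr.
by rewrite subrK add0r.
Qed.

Lemma LRR_addr_ge0 x y : le 0 x -> le 0 y -> le 0 (x + y).
Proof.
move=> x_ge0 /(LRR_add le_LRR x); rewrite add0r addrC.
exact: (LRR_trans le_LRR).
Qed.

Lemma LRR_mulrn_ge0 x k : le 0 x -> le 0 (x *+ k).
Proof.
move=> x_ge0; elim: k => [|k IH].
  by rewrite mulr0n; apply: (LRR_refl le_LRR).
by rewrite mulrS; apply: LRR_addr_ge0.
Qed.

Lemma LRR_emb_ge0 c x : 0 <= c -> le 0 x -> le 0 (emb c * x).
Proof.
move=> c_ge0 x_ge0; apply: (LRR_unperforated le_LRR (k := absz (denq c))).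
  by rewrite absz_gt0 denq_eq0.
rewrite -mulr_natr mulrAC [_%:R]pmulrn gtz0_abs ?denq_gt0 // rat_emb_mul_denq.
have : 0 <= numq c by rewrite numq_ge0.
by case: (numq c) => // k _; rewrite -pmulrn mulr_natl; apply: LRR_mulrn_ge0.
Qed.

Lemma LRR_emb_gt0 c x : 0 < c -> le 0 (emb c * x) <-> le 0 x.
Proof.
move=> c_gt0; split=> [cx_ge0|]; last exact/LRR_emb_ge0/ltW.
rewrite -[x]mul1r -(rmorph1 emb) -(mulVf (lt0r_neq0 c_gt0)) rmorphM -mulrA.
by apply: LRR_emb_ge0; rewrite // invr_ge0 ltW.
Qed.

Lemma LRR_eq0 x : le 0 x /\ le 0 (- x) <-> x = 0.
Proof.
split=> [[x_ge0 x_le0]|->].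
  by apply: (LRR_antisym le_LRR) => //; apply/LRR_subr_ge0; rewrite sub0r.
by rewrite oppr0; split; apply: (LRR_refl le_LRR).
Qed.

End LRRTheory.

Section PolynomialAtoms.
Variable n : nat.
Implicit Types (p : {mpoly rat[n]}) (m : 'X_{1..n}).

Lemma term_poly_nat k : term_poly (term_nat n k) = k%:R.
Proof. by elim: k => //= k; rewrite /term_poly /= => ->; rewrite mulrS. Qed.

Lemma term_poly_mon m : term_poly (term_mon m) = 'X_[m].
Proof.
rewrite mpolyXE_id -[RHS]big_enum /= /term_mon.
elim: (enum 'I_n) => [|i s IH] /=; first by rewrite big_nil.
rewrite big_cons -IH; elim: (m i) => [|k IHk] /=; first by rewrite expr0 mul1r.
by rewrite /term_poly /= in IHk *; rewrite IHk exprS mulrA.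
Qed.

Lemma term_poly_part p s : term_poly (term_part p s) =
  \sum_(m <- s) (absz (numq ((common_den p)%:~R * p@_m)))%:R *: 'X_[m].
Proof.
rewrite /term_part; elim: s => [|m s IH] /=; first by rewrite big_nil.
rewrite big_cons -IH /term_poly /= -!/(term_poly _); congr (_ + _).
by rewrite term_poly_nat term_poly_mon scaler_nat mulr_natl.
Qed.

Lemma common_den_gt0 p : 0 < (common_den p)%:~R :> rat.
Proof. by rewrite ltr0z; apply: prodr_gt0 => m _; apply: denq_gt0. Qed.

Lemma numq_common_denM p m : m \in msupp p ->
  (numq ((common_den p)%:~R * p@_m))%:~R = (common_den p)%:~R * p@_m :> rat.
Proof.
move=> mp; rewrite /common_den (big_rem m) //= [denq _ * _]mulrC intrM -mulrA.
by rewrite [(denq _)%:~R * _]mulrC -numqE -intrM numq_int.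
Qed.

Lemma term_poly_posB p :
  term_poly (term_pos p) - term_poly (term_neg p) = (common_den p)%:~R *: p.
Proof.
have den_gt0 := common_den_gt0 p.
rewrite !term_poly_part -sumrN !big_filter [X in _ *: X](mpolyE p) scaler_sumr.
rewrite [RHS](bigID (fun m => 0 < p@_m)) /=; congr (_ + _).
  rewrite big_seq_cond [RHS]big_seq_cond; apply: eq_bigr => m /andP[mp pm_gt0].
  rewrite scalerA pmulrn gez0_abs ?numq_common_denM //.
  by rewrite numq_ge0 mulr_ge0 // ltW.
rewrite big_seq_cond [RHS]big_seq_cond; apply: eq_big => m.
  by rewrite mcoeff_msupp; case: ltgtP.
move=> /andP[mp pm_lt0]; rewrite scalerA -scaleNr pmulrn lez0_abs.
  by rewrite rmorphN /= opprK numq_common_denM.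
by rewrite numq_le0 mulr_ge0_le0 // ltW.
Qed.

Lemma tval_rmorphism (R : comNzRingType) (v : 'I_n -> R)
    (phi : {rmorphism {mpoly rat[n]} -> R}) s :
  (forall i, phi 'X_i = v i) -> Defs.tval v s = phi (term_poly s).
Proof.
move=> phiX; elim: s => [i|||s IHs u IHu|s IHs u IHu]; rewrite /term_poly /=.
- by rewrite phiX.
- by rewrite rmorph0.
- by rewrite rmorph1.
- by rewrite rmorphD /= IHs IHu.
- by rewrite rmorphM /= IHs IHu.
Qed.

Definition atom_polys (a : atom n) := literal_polys (true, a).

End PolynomialAtoms.

Section ModelCone.
Variables (n : nat) (R : comNzRingType) (le : R -> R -> Prop) (v : 'I_n -> R).
Hypothesis le_LRR : LRR le.
Implicit Types (p q : {mpoly rat[n]}) (W : {set 'I_n}) (ZP : zp_pair n).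

Local Notation emb := (rat_emb (LRR_natr_inv le_LRR)).
Local Notation eval := (mmap emb v).

Lemma tval_term_poly s : Defs.tval v s = eval (term_poly s).
Proof. by apply: tval_rmorphism => i /=; rewrite mmapX mmap1U. Qed.

Lemma holds_FLe0 p : holds le v (FLe0 p) <-> le 0 (eval p).
Proof.
rewrite /holds /= -(LRR_subr_ge0 le_LRR) !tval_term_poly -rmorphB /=.
by rewrite term_poly_posB mmapZ; apply/LRR_emb_gt0/common_den_gt0.
Qed.

Lemma holds_FEq0 p : holds le v (FEq0 p) <-> eval p = 0.
Proof.
have den_gt0 := common_den_gt0 p; rewrite -(LRR_eq0 le_LRR).
rewrite -(LRR_emb_gt0 le_LRR _ den_gt0).
rewrite -(LRR_emb_gt0 le_LRR (- _) den_gt0) mulrN (LRR_eq0 le_LRR).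
rewrite -mmapZ -term_poly_posB rmorphB /= -!tval_term_poly.
split=> [/= ->|/eqP]; first by rewrite subrr.
by rewrite subr_eq0 => /eqP/esym.
Qed.

Lemma atom_holds_polys a : atom_holds le v a <->
  {in atom_polys a, forall q, holds le v (FLe0 q)}.
Proof.
case: a => s u /=; rewrite !tval_term_poly.
  rewrite -(LRR_subr_ge0 le_LRR) -rmorphB /= -holds_FLe0.
  by split=> [holds_q q|]; [rewrite inE => /eqP ->|apply; rewrite inE].
have -> : eval (term_poly s) = eval (term_poly u) <->
    eval (term_poly u - term_poly s) = 0.
  rewrite rmorphB /=; split=> [->|/eqP]; first by rewrite subrr.
  by rewrite subr_eq0 => /eqP.
rewrite -(LRR_eq0 le_LRR) -rmorphN -!holds_FLe0.
split=> [[ge0 le0] q|holds_q]; first by rewrite !inE => /orP[]/eqP ->.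
by split; apply: holds_q; rewrite !inE eqxx ?orbT.
Qed.

Lemma model_cone_regular W :
  regular_cone W (fun p => poly_over W p /\ holds le v (FLe0 p)).
Proof.
have units p : (poly_over W p /\ holds le v (FLe0 p)) /\
    (poly_over W (- p) /\ holds le v (FLe0 (- p))) <->
    poly_over W p /\ eval p = 0.
  rewrite !holds_FLe0 rmorphN -(LRR_eq0 le_LRR).
  by split=> [[[? ?] [? ?]]|[pW [? ?]]]; do !split=> //; apply: poly_overN.
split; last 1 first.
- split=> [p /units[]//||p q /units[pW p0] /units[qW q0]|p q pW /units[qW q0]];
    apply/units.
  + by rewrite poly_over0 rmorph0.
  + by rewrite poly_overD // rmorphD /= p0 q0 addr0.
  + by rewrite poly_overM // rmorphM /= q0 mulr0.
- split=> [p []//||p q [pW] + [qW]|c p c_ge0 [pW]]; rewrite !holds_FLe0.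
  + by rewrite poly_over0 rmorph0; split=> //; apply: (LRR_refl le_LRR).
  + by rewrite rmorphD; split; [apply: poly_overD|apply: LRR_addr_ge0].
  + by rewrite mmapZ; split; [apply: poly_overZ|apply: LRR_emb_ge0].
by rewrite holds_FLe0 rmorph1 poly_over1; split=> //; apply: (LRR_le01 le_LRR).
Qed.

Lemma model_cone_proper : ~ holds le v (FLe0 (-1)).
Proof.
rewrite holds_FLe0 rmorphN rmorph1 => N1_ge0.
have /eqP := oner_neq0 R; apply; apply/(LRR_eq0 le_LRR); split=> //.
exact: (LRR_le01 le_LRR).
Qed.

Lemma holds_foldr_FAnd (f : {mpoly rat[n]} -> formula n) S :
  holds le v (foldr (fun p g => FAnd (f p) g) FTrue S) <->
  {in S, forall p, holds le v (f p)}.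
Proof.
elim: S => [|p S IH] //=; split=> [[holds_p /IH holds_S] q|holds_pS].
  by rewrite inE => /orP[/eqP ->|/holds_S].
split; first exact/holds_pS/mem_head.
by apply/IH => q qS; apply: holds_pS; rewrite inE qS orbT.
Qed.

Lemma holds_zp_formula W ZP : holds le v (zp_formula ZP) <->
  forall p, alg_cone W ZP p -> holds le v (FLe0 p).
Proof.
split=> [[/holds_foldr_FAnd Z0 /holds_foldr_FAnd P_ge0]|ZP_ge0].
  apply: alg_cone_ind => [p q|p Zp|c p c_ge0 /P_ge0]; rewrite !holds_FLe0.
  - by rewrite rmorphD; apply: LRR_addr_ge0.
  - suff -> : eval p = 0 by apply: (LRR_refl le_LRR).
    move: p Zp; apply: ideal_gen_ind => [|p q p0 q0|p z _ /Z0/holds_FEq0 z0].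
    + exact: rmorph0.
    + by rewrite rmorphD /= p0 q0 addr0.
    + by rewrite rmorphM /= z0 mulr0.
  by rewrite mmapZ; apply: LRR_emb_ge0.
split; apply/holds_foldr_FAnd => p pS; last first.
  exact/ZP_ge0/alg_cone_cone/cone_gen_mem.
apply/holds_FEq0/(LRR_eq0 le_LRR); rewrite -rmorphN -!holds_FLe0.
by split; apply/ZP_ge0/alg_cone_ideal; [|apply: ideal_genN];
  apply: ideal_gen_mem.
Qed.

End ModelCone.

Section QuotientModel.
Variables (n : nat) (C : {mpoly rat[n]} -> Prop).
Hypotheses (C_regular : regular_cone setT C) (C_proper : ~ C (-1)).

Definition unit_ideal : {pred {mpoly rat[n]}} := fun p => `[< C p /\ C (- p) >].

Lemma unit_idealP p : reflect (C p /\ C (- p)) (p \in unit_ideal).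
Proof. exact: asboolP. Qed.

Lemma unit_ideal_closed : idealr_closed unit_ideal.
Proof.
have [_ _ [_ units0 unitsD unitsM]] := C_regular.
split; first exact/unit_idealP.
  by apply/negP => /unit_idealP[].
move=> p q r /unit_idealP units_q /unit_idealP units_r; apply/unit_idealP.
by apply: unitsD => //; apply: unitsM => //; apply: poly_overT.
Qed.

HB.instance Definition _ :=
  isIdealr.Build {mpoly rat[n]} unit_ideal unit_ideal_closed.

Let Q : comNzRingType := {ideal_quot unit_ideal}.
Local Open Scope quotient_scope.

Definition quot_le (x y : Q) : Prop := C (repr y - repr x).

Lemma quot_le_pi p q : quot_le (\pi_Q p) (\pi_Q q) <-> C (q - p).
Proof.
have [[_ _ CD _] _ _] := C_regular.
have repr_pi r : C (repr (\pi_Q r) - r) /\ C (r - repr (\pi_Q r)).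
  have /eqP := reprK (\pi_Q r); rewrite -Quotient.idealrBE => /unit_idealP.
  by rewrite opprB.
rewrite /quot_le; have [Cp Cp'] := repr_pi p; have [Cq Cq'] := repr_pi q.
split=> Cpq.
  have -> : q - p = (q - repr (\pi_Q q)) +
      ((repr (\pi_Q q) - repr (\pi_Q p)) + (repr (\pi_Q p) - p)) by ring.
  by apply: (CD) => //; apply: CD.
have -> : repr (\pi_Q q) - repr (\pi_Q p) =
    (repr (\pi_Q q) - q) + ((q - p) + (p - repr (\pi_Q p))) by ring.
by apply: (CD) => //; apply: CD.
Qed.

Lemma quot_LRR : LRR quot_le.
Proof.
have [C_cone C1 _] := C_regular; have [_ C0 CD _] := C_cone; split.
- by move=> x; rewrite /quot_le subrr.
- move=> x y z; rewrite /quot_le => Cxy Cyz.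
  by rewrite -[repr z](subrK (repr y)) -addrA; apply: CD.
- move=> x y Cxy Cyx; rewrite -[x]reprK -[y]reprK; apply/eqP.
  by rewrite -Quotient.idealrBE; apply/unit_idealP; rewrite opprB.
- move=> x y z; rewrite -[x]reprK -[y]reprK -[z]reprK -!rmorphD !quot_le_pi.
  by rewrite opprD addrACA subrr addr0.
- by rewrite -(rmorph0 \pi_Q) -(rmorph1 \pi_Q) quot_le_pi subr0.
- case=> // k _; exists (\pi_Q (k.+1%:R^-1)%:MP).
  rewrite -rmorphMn -mpolyCMn /= -[_ *+ _]mulr_natr mulVf ?pnatr_eq0 //.
  by rewrite mpolyC1 rmorph1.
case=> // k _ x; rewrite -[x]reprK -rmorphMn -(rmorph0 \pi_Q) !quot_le_pi.
by rewrite !subr0 -scaler_nat (is_cone_scale _ C_cone) ?ltr0n.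
Qed.

Lemma quotient_model : exists (R : comNzRingType) (le : R -> R -> Prop)
  (v : 'I_n -> R), LRR le /\ forall p, holds le v (FLe0 p) <-> C p.
Proof.
exists Q, quot_le, (fun i => \pi_Q 'X_i); split=> [|p]; first exact: quot_LRR.
have tvalE s : Defs.tval (fun i => \pi_Q 'X_i) s = \pi_Q (term_poly s) :> Q.
  exact: tval_rmorphism.
rewrite /holds /= !tvalE quot_le_pi term_poly_posB.
have [C_cone _ _] := C_regular.
exact: is_cone_scale C_cone (common_den_gt0 p).
Qed.

End QuotientModel.

(** * Cubes and disjunctive normal forms *)

Section DisjunctiveNormalForm.
Variable n : nat.
Implicit Types (h : atom n -> Prop) (f g : formula n) (c : cube n).
Implicit Types (D : seq (cube n)) (l : literal n).

Lemma In_cat (T : Type) (x : T) s1 s2 :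
  List.In x (s1 ++ s2) <-> List.In x s1 \/ List.In x s2.
Proof. exact: List.in_app_iff. Qed.

Lemma cube_formulaP h c : prop_eval h (cube_formula c) <->
  forall l, List.In l c -> prop_eval h (literal_formula l).
Proof.
elim: c => [|x c IH] //=; rewrite IH.
split=> [[hx hc] l [<-//|/hc //]|hxc].
by split=> [|l lc]; apply: hxc; [left|right].
Qed.

Lemma cube_formula_cat h c1 c2 : prop_eval h (cube_formula (c1 ++ c2)) <->
  prop_eval h (cube_formula c1) /\ prop_eval h (cube_formula c2).
Proof.
rewrite !cube_formulaP; split=> [h12|[h1 h2] l /In_cat[/h1|/h2]//].
by split=> l lc; apply/h12/In_cat; [left|right].
Qed.

Definition cube_product D1 D2 : seq (cube n) :=
  List.map (fun c12 : cube n * cube n => c12.1 ++ c12.2) (List.list_prod D1 D2).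

Lemma In_cube_product c D1 D2 : List.In c (cube_product D1 D2) <->
  exists c1 c2, [/\ List.In c1 D1, List.In c2 D2 & c = c1 ++ c2].
Proof.
rewrite /cube_product List.in_map_iff; split.
  by move=> [[c1 c2] [<- /List.in_prod_iff[c1D1 c2D2]]]; exists c1, c2.
move=> [c1 [c2 [c1D1 c2D2 ->]]]; exists (c1, c2); split=> //.
exact/List.in_prod_iff.
Qed.

Definition dnf_eval h D : Prop :=
  exists c, List.In c D /\ prop_eval h (cube_formula c).

Lemma dnf_eval_cat h D1 D2 :
  dnf_eval h (D1 ++ D2) <-> dnf_eval h D1 \/ dnf_eval h D2.
Proof.
split=> [[c [/In_cat[cD|cD] hc]]|[] [c [cD hc]]]; first by left; exists c.
- by right; exists c.
- by exists c; split=> //; apply/In_cat; left.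
- by exists c; split=> //; apply/In_cat; right.
Qed.

Lemma dnf_eval_cube_product h D1 D2 :
  dnf_eval h (cube_product D1 D2) <-> dnf_eval h D1 /\ dnf_eval h D2.
Proof.
split.
  move=> [c [/In_cube_product[c1 [c2 [c1D1 c2D2 ->]]]]].
  by move=> /cube_formula_cat[h1 h2]; split; [exists c1|exists c2].
move=> [[c1 [c1D1 h1]] [c2 [c2D2 h2]]]; exists (c1 ++ c2); split.
  by apply/In_cube_product; exists c1, c2.
exact/cube_formula_cat.
Qed.

Definition dnf_over (s : seq (literal n)) D : Prop :=
  forall c l, List.In c D -> List.In l c -> List.In l s.

Lemma dnf_over_cat s1 s2 D1 D2 :
  dnf_over s1 D1 -> dnf_over s2 D2 -> dnf_over (s1 ++ s2) (D1 ++ D2).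
Proof.
move=> D1s D2s c l /In_cat cD lc; apply/In_cat.
by case: cD => cD; [left; apply: D1s lc|right; apply: D2s lc].
Qed.

Lemma dnf_over_cube_product s1 s2 D1 D2 :
  dnf_over s1 D1 -> dnf_over s2 D2 -> dnf_over (s1 ++ s2) (cube_product D1 D2).
Proof.
move=> D1s D2s c l /In_cube_product[c1 [c2 [c1D1 c2D2 ->]]] /In_cat lc.
apply/In_cat.
by case: lc => lc; [left; apply: D1s lc|right; apply: D2s lc].
Qed.

Fixpoint dnf (b : bool) f : seq (cube n) :=
  match f with
  | FTrue => if b then [:: [::]] else [::]
  | FAtom a => [:: [:: (b, a)]]
  | FNot f => dnf (~~ b) f
  | FAnd f g =>
      if b then cube_product (dnf b f) (dnf b g) else dnf b f ++ dnf b g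
  | FOr f g =>
      if b then dnf b f ++ dnf b g else cube_product (dnf b f) (dnf b g)
  end.

Lemma dnf_over_nnf_literals b f : dnf_over (nnf_literals b f) (dnf b f).
Proof.
elim: f b => [|a|f IHf|f IHf g IHg|f IHf g IHg] b //=.
- by case: b => // c l /= [<-|].
- by move=> c l /= [<-|].
- by case: b; [apply: dnf_over_cube_product|apply: dnf_over_cat].
by case: b; [apply: dnf_over_cat|apply: dnf_over_cube_product].
Qed.

Lemma dnf_evalE b f h :
  dnf_eval h (dnf b f) <-> if b then prop_eval h f else ~ prop_eval h f.
Proof.
elim: f b => [|a|f IHf|f IHf g IHg|f IHf g IHg] b /=.
- case: b; split=> //; last by move=> [c []].
  by move=> _; exists [::]; split=> //; left.
- split=> [[c [[<-|//] /= [hb _]]]|hb]; first by case: b hb.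
  by exists [:: (b, a)]; split; [left|case: b hb].
- by rewrite IHf; case: b => //=; rewrite not_notE.
- by case: b; rewrite ?dnf_eval_cube_product ?dnf_eval_cat IHf IHg // not_andE.
by case: b; rewrite ?dnf_eval_cube_product ?dnf_eval_cat IHf IHg // not_orE.
Qed.

Lemma is_dnf_dnf f : is_dnf (dnf true f) f.
Proof.
split=> [|h]; first exact: dnf_over_nnf_literals.
by rewrite -(dnf_evalE true).
Qed.

End DisjunctiveNormalForm.

(** * Models of cubes *)

Section CubeModels.
Variable n : nat.
Implicit Types (f g : formula n) (c : cube n) (l : literal n) (a : atom n).
Implicit Types (Y : {set 'I_n}) (ZP : zp_pair n).

Definition atom_over Y a : Prop := {in atom_polys a, forall q, poly_over Y q}.

Lemma cat_subset (T : eqType) (s1 s2 : seq T) (A : {pred T}) :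
  {subset s1 ++ s2 <= A} -> {subset s1 <= A} /\ {subset s2 <= A}.
Proof. by move=> sA; split=> x xs; apply: sA; rewrite mem_cat xs ?orbT. Qed.

Lemma term_poly_over Y s : {subset tconsts s <= Y} -> poly_over Y (term_poly s).
Proof.
elim: s => [i|||s IHs u IHu|s IHs u IHu] /=; rewrite /term_poly /=.
- by move=> iY; apply/poly_overXU/iY/mem_head.
- by move=> _; apply: poly_over0.
- by move=> _; apply: poly_over1.
- by move=> /cat_subset[/IHs sY /IHu uY]; apply: poly_overD.
- by move=> /cat_subset[/IHs sY /IHu uY]; apply: poly_overM.
Qed.

Lemma aconsts_atom_over Y a : {subset aconsts a <= Y} -> atom_over Y a.
Proof.
case: a => s u /= /cat_subset[/term_poly_over sY /term_poly_over uY] q /=.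
  by rewrite inE => /eqP ->; apply: poly_overB.
by rewrite !inE => /orP[]/eqP ->; [|apply: poly_overN]; apply: poly_overB.
Qed.

Lemma nnf_literals_over Y b f l :
  formula_over Y f -> List.In l (nnf_literals b f) -> atom_over Y l.2.
Proof.
rewrite /formula_over; elim: f b => [|a|f IHf|f IHf g IHg|f IHf g IHg] b //=.
- by move=> aY [<-|//]; apply: aconsts_atom_over.
- exact: IHf.
- by move=> /cat_subset[fY gY] /In_cat[]; [apply: IHf|apply: IHg].
- by move=> /cat_subset[fY gY] /In_cat[]; [apply: IHf|apply: IHg].
Qed.

Lemma nnf_literals_foldr_FAnd b (F : {mpoly rat[n]} -> formula n) S l :
  List.In l (nnf_literals b (foldr (fun p g => FAnd (F p) g) FTrue S)) ->
  exists2 p, p \in S & List.In l (nnf_literals b (F p)).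
Proof.
elim: S => //= p S IH /In_cat[lp|/IH[q qS lq]].
  by exists p; rewrite ?mem_head.
by exists q; rewrite // inE qS orbT.
Qed.

Lemma nnf_literals_zp_formula Y ZP l : zp_over Y ZP ->
  List.In l (nnf_literals false (zp_formula ZP)) ->
  l.1 = false /\ atom_over Y l.2.
Proof.
move=> [ZY PY] /In_cat[] /nnf_literals_foldr_FAnd[p pS [<-|//]]; split=> // q;
  rewrite /atom_polys /= !inE term_poly_posB.
  by case/orP=> /eqP ->; [|apply: poly_overN]; apply/poly_overZ/ZY.
by move=> /eqP ->; apply/poly_overZ/PY.
Qed.

Lemma mem_cube_polys c q :
  q \in cube_polys c <-> exists2 a, List.In (true, a) c & q \in atom_polys a.
Proof.
elim: c => [|[b a] c IH]; first by split=> [//|[]].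
rewrite /cube_polys /= mem_cat -/(cube_polys c); split.
  case/orP => [|/IH[a' a'c qa']]; last by exists a' => //; right.
  by case: b => // qa; exists a => //; left.
move=> [a' [[-> ->] qa|a'c qa']]; apply/orP; first by left.
by right; apply/IH; exists a'.
Qed.

Section InModel.
Variables (R : comNzRingType) (le : R -> R -> Prop) (v : 'I_n -> R).
Hypothesis le_LRR : LRR le.

Lemma cube_polys_hold c : holds le v (cube_formula c) ->
  {in cube_polys c, forall q, holds le v (FLe0 q)}.
Proof.
move=> /cube_formulaP hc q /mem_cube_polys[a /hc /= ha qa].
exact: (proj1 (atom_holds_polys v le_LRR a) ha).
Qed.

Lemma least_regular_cone_holds Y S C : least_regular_cone Y S C ->
  {in S, forall q, holds le v (FLe0 q)} -> forall p, C p -> holds le v (FLe0 p).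
Proof.
move=> [[[CY _ _ _] _ _] SC C_min] holds_S p Cp.
have [|_ //] := C_min _ (model_cone_regular v le_LRR Y) _ p Cp.
by move=> q qS; split; [apply/CY/SC|apply: holds_S].
Qed.

End InModel.

Lemma cube_generic_model Y c C : satisfiable (cube_formula c) ->
  (forall l, List.In l c -> atom_over Y l.2) ->
  least_regular_cone Y (cube_polys c) C ->
  exists (R : comNzRingType) (le : R -> R -> Prop) (v : 'I_n -> R),
    [/\ LRR le, holds le v (cube_formula c)
      & forall p, poly_over Y p -> holds le v (FLe0 p) -> C p].
Proof.
move=> [R0 [le0 [v0 [LRR0 hc0]]]] cY C_least; have [C_reg SC _] := C_least.
have C_holds0 p : C p -> holds le0 v0 (FLe0 p).
  by apply: (least_regular_cone_holds LRR0 C_least); apply: cube_polys_hold.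
have CN1 : ~ C (restrict_vars Y (-1)).
  rewrite restrict_vars_id; last exact/poly_overN/poly_over1.
  by move=> /C_holds0; apply: model_cone_proper.
have [R [le [v [le_LRR holdsE]]]] :=
  quotient_model (regular_cone_restrict_vars C_reg) CN1.
have holds_overE p : poly_over Y p -> holds le v (FLe0 p) <-> C p.
  by move=> pY; rewrite holdsE restrict_vars_id.
exists R, le, v; split=> // [|p pY /(holds_overE p pY) //].
apply/cube_formulaP => -[[] a] lc /=.
  apply/(atom_holds_polys v le_LRR) => q qa.
  by apply/(holds_overE q (cY _ lc q qa))/SC/mem_cube_polys; exists a.
move=> /(atom_holds_polys v le_LRR) ha.
apply: (proj1 (cube_formulaP _ _) hc0 _ lc).
apply/(atom_holds_polys v0 LRR0) => q qa.
exact/C_holds0/(holds_overE q (cY _ lc q qa))/ha.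
Qed.

End CubeModels.

(** * The consequence procedure *)

Lemma Acc_invariant_measure (T : Type) (R : T -> T -> Prop) (I : T -> Prop)
    (f : T -> nat) :
  (forall x y, I x -> R x y -> I y /\ (f y < f x)%N) ->
  forall x, I x -> Acc (fun y z => R z y) x.
Proof.
move=> I_step x; have [k] := ubnP (f x); elim: k x => [x|k IH x le_fx Ix].
  by rewrite ltn0.
split=> y /(I_step x y Ix)[Iy lt_fy]; apply: IH Iy.
exact: leq_trans lt_fy le_fx.
Qed.

Section Consequence.
Variables (n : nat) (le : rel 'X_{1..n}) (Y X : {set 'I_n}) (t : 'I_n).
Variable F : formula n.
Hypotheses (le_mo : monomial_order le) (X_sub_Y : X \subset Y).
Hypotheses (t_fresh : t \notin Y) (F_over_Y : formula_over Y F).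
Implicit Types (G : formula n) (ZP : zp_pair n).

Record loop_inv G ZP : Prop := LoopInv {
  loop_positive : forall a, List.In (true, a) (nnf_literals true G) ->
    List.In (true, a) (nnf_literals true F);
  loop_atom_over : forall l, List.In l (nnf_literals true G) -> atom_over Y l.2;
  loop_entails : entails G F;
  loop_reduced : reduced le X ZP;
  loop_zp_over : zp_over X ZP;
  loop_complete : forall p, Cn X F p -> alg_cone X ZP p;
  loop_sound : forall (R : comNzRingType) (leR : R -> R -> Prop)
      (v : 'I_n -> R),
    LRR leR -> holds leR v F ->
    holds leR v G \/ forall p, alg_cone X ZP p -> holds leR v (FLe0 p)
}.

Definition cube_cone G ZP : Prop := zp_over Y ZP /\
  exists c : cube n,
    [/\ forall l, List.In l c -> List.In l (nnf_literals true G),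
        entails (cube_formula c) G, satisfiable (cube_formula c)
      & least_regular_cone Y (cube_polys c) (alg_cone Y ZP)].

Definition projected_cube_cone G ZP : Prop := zp_over X ZP /\
  exists2 ZP', cube_cone G ZP' &
    forall p, alg_cone X ZP p <-> alg_cone Y ZP' p /\ poly_over X p.

Definition config_inv (k : config n) : Prop :=
  match k with
  | AtTest G ZP => loop_inv G ZP
  | AtProject G ZP ZP' => loop_inv G ZP /\ cube_cone G ZP'
  | AtIntersect G ZP ZP' => loop_inv G ZP /\ projected_cube_cone G ZP'
  | Returned ZP => reduced le X ZP /\ forall p, alg_cone X ZP p <-> Cn X F p
  end.

Lemma reduced_one : reduced le X ([:: 1], [:: 0]).
Proof.
split=> [|p /=]; last by rewrite inE => /eqP ->; apply/normal_form_id/in_span0.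
split=> // p m _ _; exists 1, 0%MM; split; first exact: mem_head.
  by rewrite -mpolyX0; apply: lead_monX.
by apply/mnm_lepP => i; rewrite mnm0E.
Qed.

Lemma config_inv_initial : config_inv (initial F).
Proof.
split=> //.
- by move=> l; apply: nnf_literals_over.
- exact: reduced_one.
- by split=> p; rewrite inE => /eqP ->; [apply: poly_over1|apply: poly_over0].
- move=> p [pX _]; apply: alg_cone_ideal; rewrite -[p]mulr1.
  exact/ideal_genM/ideal_gen_mem/mem_head.
by move=> R leR v _ hF; left.
Qed.

Lemma get_model_cube_cone G ZP : get_model le Y G ZP -> cube_cone G ZP.
Proof.
move=> [D [c [[DG DE] cD c_sat _ c_least]]].
have [[[CY _ _ _] _ _] _ _] := c_least; split.
  split=> p pZP; apply: CY; first exact/alg_cone_ideal/ideal_gen_mem.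
  exact/alg_cone_cone/cone_gen_mem.
exists c; split=> // [l|R leR v _ hc]; first exact: DG cD.
by apply/DE; exists c.
Qed.

Lemma get_model_exists G : satisfiable G ->
  (forall l, List.In l (nnf_literals true G) -> atom_over Y l.2) ->
  exists ZP, get_model le Y G ZP.
Proof.
move=> [R [leR [v [leR_LRR hG]]]] GY; have [DG DE] := is_dnf_dnf G.
have [c [cD hc]] := proj1 (DE _) hG.
have cY : {in cube_polys c, forall p, poly_over Y p}.
  by move=> p /mem_cube_polys[a ac pa]; apply: (GY _ (DG _ _ cD ac)).
have [ZP0 ZP0Y c_least] := least_regular_cone_exists cY.
have [ZP ZP_red ZPE] := reduced_exists le_mo ZP0Y.
exists ZP, (dnf true G), c; split=> //; first by exists R, leR, v.
by have -> : alg_cone Y ZP = alg_cone Y ZP0 by apply/predeqP.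
Qed.

Lemma Cn_sub_cube_cone G ZP ZP' p : loop_inv G ZP -> cube_cone G ZP' ->
  Cn X F p -> alg_cone Y ZP' p.
Proof.
move=> inv [_ [c [cG c_ent c_sat c_least]]] [pX F_p].
have cY l : List.In l c -> atom_over Y l.2 by move=> /cG/(loop_atom_over inv).
have [R [leR [v [leR_LRR hc hC]]]] := cube_generic_model c_sat cY c_least.
apply: hC; first exact: poly_overS pX.
exact: F_p (loop_entails inv leR_LRR (c_ent _ _ _ leR_LRR hc)).
Qed.

Lemma project_cube_cone G ZP ZP' : cube_cone G ZP -> project le Y X ZP ZP' ->
  projected_cube_cone G ZP'.
Proof.
move=> ZP_cube prj; have [ZPY _] := ZP_cube.
split; first exact: project_over prj.
by exists ZP => //; apply: project_cone prj.
Qed.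

Lemma intersect_coneE ZP ZP' ZP'' : zp_over X ZP -> zp_over X ZP' ->
  intersect le X t ZP ZP' ZP'' ->
  forall p, alg_cone X ZP'' p <-> alg_cone X ZP p /\ alg_cone X ZP' p.
Proof.
by apply: intersect_cone => //; apply: contra t_fresh => /(subsetP X_sub_Y).
Qed.

Lemma loop_inv_intersect G ZP ZP' ZP'' :
  loop_inv G ZP -> projected_cube_cone G ZP' -> intersect le X t ZP ZP' ZP'' ->
  loop_inv (FAnd G (FNot (zp_formula ZP''))) ZP''.
Proof.
move=> inv [ZP'X [ZPc ZPc_cube ZP'E]] isect.
have coneE := intersect_coneE (loop_zp_over inv) ZP'X isect.
have ZP''X : zp_over X ZP'' := project_over isect.
split=> //=.
- by move=> a /In_cat[/(loop_positive inv)|/(nnf_literals_zp_formula ZP''X)[]].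
- move=> l /In_cat[/(loop_atom_over inv) //|].
  by move=> /(nnf_literals_zp_formula ZP''X)[_ lX] q /lX; apply: poly_overS.
- by move=> R leR v hR [hG _]; apply: (loop_entails inv).
- exact: intersect_reduced isect.
- move=> p F_p; apply/coneE; split; first exact: (loop_complete inv).
  by apply/ZP'E; split; [apply: Cn_sub_cube_cone inv ZPc_cube F_p|case: F_p].
move=> R leR v leR_LRR hF.
case: (loop_sound inv leR_LRR hF) => [hG|holds_ZP]; last first.
  by right=> p /coneE[/holds_ZP].
have [|not_ZP''] := pselect (holds leR v (zp_formula ZP'')); last by left.
by move=> /(holds_zp_formula v leR_LRR X); right.
Qed.

Lemma loop_inv_unsat G ZP : loop_inv G ZP -> ~ satisfiable G ->
  forall p, alg_cone X ZP p <-> Cn X F p.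
Proof.
move=> inv unsat p; split=> [ZPp|]; last exact: (loop_complete inv).
split=> [|R leR v leR_LRR hF].
  exact: alg_cone_over (loop_zp_over inv) _ ZPp.
case: (loop_sound inv leR_LRR hF) => [hG|]; last exact.
by case: unsat; exists R, leR, v.
Qed.

Lemma config_inv_step k k' :
  config_inv k -> step le Y X t k k' -> config_inv k'.
Proof.
move=> + k_step; case: k_step => [G ZP ZP' _ /get_model_cube_cone|||] //=.
- move=> G ZP ZP' ZP'' prj [inv ZP'_cube]; split=> //.
  exact: project_cube_cone prj.
- move=> G ZP ZP' ZP'' isect [inv ZP'_cube].
  exact: loop_inv_intersect isect.
move=> G ZP unsat inv; split; first exact: loop_reduced inv.
exact: loop_inv_unsat unsat.
Qed.

Lemma config_inv_progress k : config_inv k ->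
  (exists k', step le Y X t k k') \/ (exists ZP, k = Returned ZP).
Proof.
case: k => [G ZP inv|G ZP ZP' [inv [ZP'Y _]]|G ZP ZP' [inv [ZP'X _]]|ZP _] /=;
  [left|left|left|by right; exists ZP].
- have [sat|unsat] := pselect (satisfiable G); last first.
    by exists (Returned ZP); apply: step_return.
  have [ZP' GZP'] := get_model_exists sat (loop_atom_over inv).
  by exists (AtProject G ZP ZP'); apply: step_get_model.
- have [ZP'' prj] := project_exists X le_mo ZP'Y.
  by exists (AtIntersect G ZP ZP''); apply: step_project.
have [ZP'' isect] := intersect_exists t le_mo (loop_zp_over inv) ZP'X.
by eexists; apply: step_intersect isect.
Qed.

Definition positive_polys := cube_polys (nnf_literals true F).

Definition realizable G (A : {set seq_sub positive_polys}) : Prop :=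
  exists (R : comNzRingType) (leR : R -> R -> Prop) (v : 'I_n -> R),
    [/\ LRR leR, holds leR v G & {in A, forall q, holds leR v (FLe0 (val q))}].

Definition realizable_sets G : {set {set seq_sub positive_polys}} :=
  [set A | `[< realizable G A >]].

Lemma realizable_setsP G A : reflect (realizable G A) (A \in realizable_sets G).
Proof. by rewrite inE; apply: asboolP. Qed.

(* The positive polynomials of the chosen cube are realizable with G, but no
   longer once the cone that they generate has been excluded. *)
Lemma realizable_sets_decr G ZP ZP' ZP'' :
  loop_inv G ZP -> projected_cube_cone G ZP' -> intersect le X t ZP ZP' ZP'' ->
  (#|realizable_sets (FAnd G (FNot (zp_formula ZP'')))| <
   #|realizable_sets G|)%N.
Proof.
move=> inv [ZP'X [ZPc [_ [c [cG c_ent c_sat c_least]]] ZP'E]] isect.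
have coneE := intersect_coneE (loop_zp_over inv) ZP'X isect.
apply/proper_card/properP; split.
  apply/subsetP => A /realizable_setsP[R [leR [v [leR_LRR [hG _] hA]]]].
  by apply/realizable_setsP; exists R, leR, v.
exists [set q : seq_sub positive_polys | val q \in cube_polys c].
  have [R [leR [v [leR_LRR hc]]]] := c_sat.
  apply/realizable_setsP; exists R, leR, v; split=> //; first exact: c_ent.
  by move=> q; rewrite inE; apply: cube_polys_hold.
apply/realizable_setsP => -[R [leR [v [leR_LRR [_ not_ZP''] hA]]]].
apply: not_ZP''.
apply/(holds_zp_formula v leR_LRR X) => p /coneE[_ /ZP'E[ZPc_p _]].
apply: (least_regular_cone_holds leR_LRR c_least _ ZPc_p) => q qc.
have qF : q \in positive_polys.
  have /mem_cube_polys[a ac qa] := qc.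
  by apply/mem_cube_polys; exists a => //; apply/(loop_positive inv)/cG.
by apply: (hA (SeqSub qF)); rewrite inE.
Qed.

Definition config_weight (k : config n) : nat :=
  match k with
  | AtTest G _ => 3 * #|realizable_sets G|.+1
  | AtProject G _ _ => (3 * #|realizable_sets G|).+2
  | AtIntersect G _ _ => (3 * #|realizable_sets G|).+1
  | Returned _ => 0
  end.

Lemma config_weight_step k k' : config_inv k -> step le Y X t k k' ->
  (config_weight k' < config_weight k)%N.
Proof.
move=> + k_step; case: k_step => [G ZP ZP' _ _ _|G ZP ZP' ZP'' _ _||//] /=.
- by rewrite mulnS.
- exact: ltnSn.
move=> G ZP ZP' ZP'' isect [inv ZP'_cube]; rewrite ltnS leq_pmul2l //.
exact: realizable_sets_decr isect.
Qed.

Lemma config_inv_reachable k : reachable le Y X t F k -> config_inv k.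
Proof.
rewrite /reachable => reach_k; elim: reach_k config_inv_initial => //.
  by move=> k1 k2 k12 inv; apply: config_inv_step k12.
by move=> k1 k2 k3 _ inv12 _ inv23 /inv12.
Qed.

End Consequence.

Theorem theorem3p12 (n : nat) (le : rel 'X_{1..n}) (Y X : {set 'I_n}) (t : 'I_n)
    (F : formula n)
    (le_monomial_order : monomial_order le)
    (X_sub_Y : X \subset Y)
    (t_fresh : t \notin Y)
    (F_over_Y : formula_over Y F) :
  consequence_terminates le Y X t F /\
  (forall ZP : zp_pair n, consequence_returns le Y X t F ZP ->
     reduced le X ZP /\
     (forall p : {mpoly rat[n]}, alg_cone X ZP p <-> Cn X F p)).
Proof.
have inv := config_inv_reachable le_monomial_order X_sub_Y t_fresh F_over_Y.
split=> [|ZP /inv //]; split=> [|k /inv]; last exact: config_inv_progress.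
apply: Acc_invariant_measure (config_inv_initial X le_monomial_order F_over_Y).
move=> k k' k_inv k_step; split; first exact: config_inv_step k_inv k_step.
exact: config_weight_step k_inv k_step.
Qed.
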